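(* Let $\lambda$ be a partition and $m\ge1$. For any $\mu\in\mathbb{N}^m$ and any distinct $i,j\in[m]$, \[ K_{\lambda\mu}^2 \ge K_{\lambda\, \mu(i,j)}\, K_{\lambda\, \mu(j,i)}, \] where $\mu(i,j)=\mu+e_i-e_j$.
   Context: A partition is a weakly decreasing sequence of nonnegative integers. For $\nu\in\mathbb{Z}^m$, the Kostka number $K_{\lambda\nu}$ is the number of semistandard Young tableaux of shape $\lambda$ with entries in $[m]$ having exactly $\nu_k$ entries equal to $k$ for each $k$ (equivalently, the coefficient of $x^\nu$ in the Schur polynomial $s_\lambda(x_1,\ldots,x_m)$); it is $0$ if $\nu$ has a negative entry. Here $e_i$ denotes the $i$-th standard unit vector of $\mathbb{Z}^m$. *)

(* Defs.v *)
From HB Require Import structures.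
From mathcomp Require Import all_boot all_order all_algebra.

Set Implicit Arguments.
Unset Strict Implicit.
Unset Printing Implicit Defensive.

Import Order.TTheory GRing.Theory Num.Theory.
Local Open Scope ring_scope.

(* Trailing zeros are allowed; they contribute empty rows to the diagram. *)
Definition is_partition (la : seq nat) : bool := sorted geq la.

(* The Young diagram of la (English convention): Tagged _ c, with c : 'I_(la_r),
   is the cell in row r and column c; both indices are 0-based. *)
Definition cell (la : seq nat) : finType :=
  {r : 'I_(size la) & 'I_(nth 0%N la r)}.

Definition cell_row (la : seq nat) (c : cell la) : nat := tag c.
Definition cell_col (la : seq nat) (c : cell la) : nat := tagged c.

(* The alphabet {1, ..., m} is represented by 'I_m = {0, ..., m-1}. *)
Definition semistandard (la : seq nat) (m : nat)
    (T : {ffun cell la -> 'I_m}) : bool :=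
  [forall c : cell la, forall d : cell la,
     ((cell_row c == cell_row d) && (cell_col c < cell_col d)%N
        ==> (T c <= T d)%N)
     && ((cell_col c == cell_col d) && (cell_row c < cell_row d)%N
        ==> (T c < T d)%N)].

Definition content (la : seq nat) (m : nat)
    (T : {ffun cell la -> 'I_m}) (k : 'I_m) : nat :=
  #|[set c : cell la | T c == k]|.

Definition kostka (la : seq nat) (m : nat) (nu : 'rV[int]_m) : nat :=
  #|[set T : {ffun cell la -> 'I_m} |
      semistandard T && [forall k : 'I_m, (content T k)%:Z == nu ord0 k]]|.

Lemma kostka_neg (la : seq nat) (m : nat) (nu : 'rV[int]_m) (k : 'I_m) :
  nu ord0 k < 0 -> kostka la nu = 0%N.
Proof.
move=> nuk_lt0; apply/eqP; rewrite cards_eq0; apply/eqP/setP => T.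
rewrite !inE; apply/negbTE/negP => /andP[_ /forallP/(_ k)/eqP Tk].
by rewrite -Tk in nuk_lt0.
Qed.

Definition shift_weight (m : nat) (nu : 'rV[int]_m) (i j : 'I_m) : 'rV[int]_m :=
  nu + delta_mx ord0 i - delta_mx ord0 j.

(* Main.v *)
(* The weight mu is read through the chain of shapes of a tableau, and the
   multiplicities become intersection numbers of a tower of projective bundles
   over a resolution of a Schubert variety; the inequality is the Hodge index
   theorem for them, which is proved by hand.  Write F(z) for the number of
   tableaux with row lengths and letter multiplicities recorded in z, extended
   to all integer vectors by antisymmetry in the (shifted) rows.  The quadratic
   form u |-> sum_{x,y} u_x u_y F(z - e_x - e_y) is shown to be nonpositive on
   a hyperplane.  Inserting the last letter row by row splits such a form into
   two simpler ones which have a linear form in common, and two forms which are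
   nonpositive on hyperplanes can be glued along a nonzero common linear form
   (lorentzian_glue).  In order that this linear form does not vanish, each
   letter may also be replaced by eps times a free box; one lets eps tend to 0
   at the end. *)

(* The splitting is the recursion of a geometric series: with z' = z + e_P - e_i, the value at z
   after inserting P in row i is the value before it at z plus the value after it at z'. Applied
   after subtracting e_i, the same recursion says that row i of the first matrix is row P minus row
   i of the second; this is the common linear form, and the sum of self-pairings needed for gluing
   collapses to one value of known sign. The obstacle is nonvanishing. Counts of tableaux vanish
   outside the dominance order, so a priori the common form can be zero while neither summand is.
   The perturbation makes every count of the right size positive. *)
Require Import Defs.
From HB Require Import structures.
From mathcomp Require Import all_boot all_order all_algebra all_fingroup.
From mathcomp Require Import ring lra zify.

Set Implicit Arguments.
Unset Strict Implicit.
Unset Printing Implicit Defensive.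

Import Order.TTheory GRing.Theory Num.Theory.
Local Open Scope ring_scope.

(** * Quadratic forms that are nonpositive on a hyperplane *)

Section Lorentzian.

Variables (R : realFieldType) (V : lmodType R).
Implicit Types (B C Q : V -> V -> R) (l : V -> R) (u v w : V).

Definition linear_form l := forall a u v, l (a *: u + v) = a * l u + l v.

Definition sym_bilinear B :=
  (forall u v, B u v = B v u) /\ (forall w, linear_form (B^~ w)).

(** The form [l] may be zero: at most one positive direction is asked for, so negative semidefinite
    forms are included. *)
Definition lorentzian B :=
  exists2 l, linear_form l & forall u, l u = 0 -> B u u <= 0.

Lemma sym_bilinear_expand B a u v : sym_bilinear B ->
  B (a *: u + v) (a *: u + v) = a ^+ 2 * B u u + a * B u v *+ 2 + B v v.
Proof.
case=> Bs Bl; rewrite (Bl _ a u v) /= (Bs u) (Bs v) !Bl (Bs v u); ring.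
Qed.

(** A vector [v] with [B v v > 0] lies outside the kernel of [l], so [w] and [v0] can be moved into
    that kernel along [v]. The first move forces [w] to be isotropic and in the kernel; adding a
    multiple of [w] to the moved [v0] then makes the form positive there. *)
Lemma lorentzian_perp B w v0 v : sym_bilinear B -> lorentzian B ->
  0 <= B w w -> B w v0 != 0 -> B w v = 0 -> B v v <= 0.
Proof.
move=> Bb [l ll ln] Bww k0 Bwv; rewrite leNgt; apply/negP => Bvv.
have lv0 : l v != 0.
  by apply/negP => /eqP /ln; rewrite leNgt Bvv.
have l1 a u : l (a *: v + u) = a * l v + l u by rewrite ll.
have Bwv' : B v w = 0 by rewrite (proj1 Bb).
have lw : l w = 0 /\ B w w = 0.
  set c := - (l w / l v).
  have /ln : l (c *: v + w) = 0 by rewrite ll /c mulNr divfK // addNr.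
  rewrite sym_bilinear_expand // Bwv' mulr0 mul0rn addr0 => le0.
  have c2 : 0 <= c ^+ 2 * B v v by rewrite mulr_ge0 ?sqr_ge0 // ltW.
  have B0 : B w w = 0 by lra.
  split=> //; move: le0; rewrite B0 addr0 => le0.
  have /eqP : c ^+ 2 * B v v = 0 by apply/eqP; rewrite eq_le le0.
  rewrite mulf_eq0 (gt_eqF Bvv) orbF sqrf_eq0 oppr_eq0 mulf_eq0 invr_eq0.
  by rewrite (negPf lv0) orbF => /eqP.
case: lw => lw Bw0.
set d := - (l v0 / l v); set u := d *: v + v0.
have lu : l u = 0 by rewrite /u ll /d mulNr divfK // addNr.
have Bwu : B w u = B w v0.
  by rewrite (proj1 Bb) /u (proj2 Bb) Bwv' mulr0 add0r (proj1 Bb).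
set s := (1 - B u u) / (B w v0 *+ 2).
have /ln : l (s *: w + u) = 0 by rewrite ll lw lu mulr0 addr0.
rewrite sym_bilinear_expand // Bw0 mulr0 add0r Bwu.
have -> : s * B w v0 *+ 2 = 1 - B u u.
  by rewrite -mulrnAr /s divfK // mulrn_eq0.
by rewrite subrK leNgt ltr01.
Qed.

(** One of [C t t] and [Q s s] is nonnegative. If both are, both forms are nonpositive on the kernel
    of the common linear form. Otherwise the negative one is outweighed by the other, and its own
    hyperplane is used after an orthogonal projection. *)
Lemma lorentzian_glue C Q t s v0 : sym_bilinear C -> sym_bilinear Q ->
  lorentzian C -> lorentzian Q -> (forall v, C t v = Q s v) -> C t v0 != 0 ->
  0 <= C t t + Q s s -> lorentzian (fun u v => C u v + Q u v).
Proof.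
have main A D x y : sym_bilinear A -> sym_bilinear D -> lorentzian A ->
  lorentzian D -> (forall v, A x v = D y v) -> A x v0 != 0 ->
  0 <= A x x + D y y -> 0 <= A x x -> lorentzian (fun u v => A u v + D u v).
  move=> Ab Db LA LD AD k0 ge0 Ax.
  have Al : linear_form (A x).
    by move=> a u v; rewrite (proj1 Ab) (proj2 Ab) !(proj1 Ab x).
  have [Dy|Dy] := leP 0 (D y y).
    exists (A x) => // u Au.
    have h1 := lorentzian_perp Ab LA Ax k0 Au.
    rewrite AD in k0; rewrite AD in Au.
    have h2 := lorentzian_perp Db LD Dy k0 Au.
    by rewrite -(addr0 0) lerD.
  case: LD => l ll ln.
  have Ax0 : 0 < A x x by lra.
  pose h := - D y y; have h0 : 0 < h by rewrite /h oppr_gt0.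
  (* As [D y y = - h], the argument of [l] is the projection of [v] onto the [D]-orthogonal of [y];
     projecting [u] adds [q ^+ 2 / h] to [D u u]. *)
  exists (fun v => l ((A x v / h) *: y + v)).
    by move=> a u v; rewrite !ll Al; field; rewrite gt_eqF.
  move=> u /ln; rewrite sym_bilinear_expand // -(AD u).
  have /(lorentzian_perp Ab LA Ax k0) : A x (- (A x u / A x x) *: x + u) = 0.
    by rewrite Al mulNr divfK ?addNr // gt_eqF.
  rewrite sym_bilinear_expand //; set q := A x u.
  have -> : (- (q / A x x)) ^+ 2 * A x x + - (q / A x x) * q *+ 2 + A u u
    = A u u - q ^+ 2 / A x x by field; rewrite gt_eqF.
  have -> : (q / h) ^+ 2 * D y y + q / h * q *+ 2 + D u u = D u u + q ^+ 2 / h.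
    have -> : D y y = - h by rewrite /h opprK.
    by field; rewrite gt_eqF.
  move=> h1 h2; have h3 : q ^+ 2 / A x x <= q ^+ 2 / h.
    by apply: ler_wpM2l; rewrite ?sqr_ge0 // lef_pV2 // /h; lra.
  lra.
move=> Cb Qb LC LQ CQ k0 ge0.
have [Ct|Ct] := leP 0 (C t t); first exact: main CQ k0 ge0 Ct.
have [||||l ll ln] := main Q C s t Qb Cb LQ LC.
- by move=> v; rewrite CQ.
- by rewrite -CQ.
- by rewrite addrC.
- lra.
by exists l => // u /ln; rewrite addrC.
Qed.

Lemma lorentzian_le B C : lorentzian C -> (forall u, B u u <= C u u) ->
  lorentzian B.
Proof. by case=> l ll ln BC; exists l => // u /ln; apply: le_trans. Qed.

(** Reversed Cauchy-Schwarz: the span of [u] and [v] meets the kernel of [l], and completing the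
    square there bounds the discriminant. *)
Lemma lorentzian_CS B u v : sym_bilinear B -> lorentzian B ->
  0 <= B u u -> 0 <= B u v -> 0 <= B v v -> B u u * B v v <= B u v ^+ 2.
Proof.
move=> Bb [l ll ln] Bu Buv Bv.
have l0 w : l w = 0 -> B w w <= 0 by apply: ln.
have [lu|lu] := eqVneq (l u) 0.
  have /eqP : B u u = 0 by apply/eqP; rewrite eq_le Bu l0.
  by move/eqP=> ->; rewrite mul0r sqr_ge0.
set c := - (l v / l u).
have /l0 : l (c *: u + v) = 0 by rewrite ll /c mulNr divfK // addNr.
rewrite sym_bilinear_expand // => le0.
have [Bu0|Bu0] := eqVneq (B u u) 0; first by rewrite Bu0 mul0r sqr_ge0.
have {Bu0} Bu0 : 0 < B u u by rewrite lt_def Bu0.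
have : B u u * (c ^+ 2 * B u u + c * B u v *+ 2 + B v v) <= 0.
  by rewrite pmulr_rle0.
have -> : B u u * (c ^+ 2 * B u u + c * B u v *+ 2 + B v v) =
  (c * B u u + B u v) ^+ 2 + (B u u * B v v - B u v ^+ 2) by ring.
have := sqr_ge0 (c * B u u + B u v); lra.
Qed.

End Lorentzian.

(** * States and insertion of a letter in a row *)

Section States.

Variables (R : realFieldType) (r m : nat).

Local Notation I := ('I_r.+1 + 'I_m)%type.
(* A state [z] records a shape and a weight: [z (inl i)] is the length of row
   [i] shifted by [i.+1], where the rows come in order of increasing length, so
   that shapes are the strictly increasing positive rows; [z (inr q)] is minus
   the multiplicity of the letter [q], so that all insertions are shifts by
   unit vectors subtracted from [z]. *)
Definition state := {ffun I -> int}.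
Definition vect := {ffun I -> R^o}.
Implicit Types (F G : state -> R) (z : state) (u v : vect) (d : I).

Definition unit_state d : state := [ffun x => if x == d then 1 else 0].
Local Notation "'δ" := unit_state.
Definition entry z d : int := z d.
Local Notation "z $[ d ]" := (entry z d) (at level 2, format "z $[ d ]").

Lemma entryD z z' d : (z + z')$[d] = z$[d] + z'$[d].
Proof. by rewrite /entry ffunE. Qed.

Lemma entryN z d : (- z)$[d] = - z$[d].
Proof. by rewrite /entry !ffunE. Qed.

Lemma entryMn z n d : (z *+ n)$[d] = z$[d] *+ n.
Proof. by rewrite /entry ffunMnE. Qed.

Lemma entry_unit d x : ('δ d)$[x] = if x == d then 1 else 0.
Proof. by rewrite /entry ffunE. Qed.

Lemma eq_inl (i j : 'I_r.+1) : (inl i == inl j :> I) = (i == j).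
Proof. by []. Qed.

Lemma eq_inr (i j : 'I_m) : (inr i == inr j :> I) = (i == j).
Proof. by []. Qed.

Definition entryE := (entryD, entryN, entryMn, entry_unit, eq_inl, eq_inr).

Definition unit_vect d : vect := [ffun x => (x == d)%:R].

(** Formally the Hessian at 0 of the exponential generating function of the numbers [F (z - a)],
    with [a] running over tuples of nonnegative integers. *)
Definition hess F z u v : R :=
  \sum_d \sum_d' (u d : R) * (v d' : R) * F (z - 'δ d - 'δ d').

Lemma hess_sym F z u v : hess F z u v = hess F z v u.
Proof.
rewrite /hess exchange_big /=; apply: eq_bigr => d _; apply: eq_bigr => d' _.
by rewrite (mulrC (u _)) addrAC.
Qed.

Lemma hess_bilinear F z : sym_bilinear (hess F z).
Proof.
split=> [u v|w a u v]; first exact: hess_sym.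
rewrite /hess mulr_sumr -big_split /=; apply: eq_bigr => d _.
rewrite mulr_sumr -big_split /=; apply: eq_bigr => d' _.
by rewrite !ffunE /GRing.scale /=; ring.
Qed.

Lemma hess_unitl F z d v :
  hess F z (unit_vect d) v = \sum_d' (v d' : R) * F (z - 'δ d - 'δ d').
Proof.
rewrite /hess (bigD1 d) //= [X in _ + X]big1 ?addr0 => [|x xd].
  by apply: eq_bigr => d' _; rewrite ffunE eqxx mul1r.
by rewrite big1 // => d' _; rewrite ffunE (negPf xd) mul0r mul0r.
Qed.

Lemma hess_unit F z d d' :
  hess F z (unit_vect d) (unit_vect d') = F (z - 'δ d - 'δ d').
Proof.
rewrite hess_unitl (bigD1 d') //= [X in _ + X]big1 ?addr0 => [|x xd].
  by rewrite ffunE eqxx mul1r.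
by rewrite ffunE (negPf xd) mul0r.
Qed.

Lemma hess_lorentzian_at d F z :
  (forall x y, x != d -> y != d -> F (z - 'δ x - 'δ y) = 0) ->
  lorentzian (hess F z).
Proof.
move=> F0; exists (fun u => u d).
  by move=> a u v; rewrite !ffunE.
move=> u u0; rewrite /hess big1 // => x _; rewrite big1 // => y _.
have [->|xd] := eqVneq x d; first by rewrite u0 !mul0r.
have [->|yd] := eqVneq y d; first by rewrite u0 mulr0 mul0r.
by rewrite F0 ?mulr0.
Qed.

Definition swap_rows (i j : 'I_r.+1) z : state :=
  [ffun d => z (tperm (inl i) (inl j) d)].

Definition alternating_at (i j : 'I_r.+1) F :=
  forall z, F (swap_rows i j z) = - F z.

Lemma entry_swap i j z d :
  (swap_rows i j z)$[d] = z$[tperm (inl i) (inl j) d].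
Proof. by rewrite /entry ffunE. Qed.

Lemma swap_rowsB i j z z' :
  swap_rows i j (z - z') = swap_rows i j z - swap_rows i j z'.
Proof. by apply/ffunP => d; rewrite !ffunE. Qed.

Lemma swap_rowsD i j z z' :
  swap_rows i j (z + z') = swap_rows i j z + swap_rows i j z'.
Proof. by apply/ffunP => d; rewrite !ffunE. Qed.

Lemma swap_rowsMn i j z n : swap_rows i j (z *+ n) = swap_rows i j z *+ n.
Proof.
by elim: n => [|n IH]; [apply/ffunP => d; rewrite !ffunE
  | rewrite !mulrS swap_rowsD IH].
Qed.

Lemma swap_rows_unit i j d :
  swap_rows i j ('δ d) = 'δ (tperm (inl i) (inl j) d).
Proof.
apply/ffunP => x; rewrite !ffunE; congr (if _ then _ else _).
by rewrite -(inj_eq (@perm_inj _ (tperm (inl i) (inl j)))) tpermK.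
Qed.

Lemma alternating_eq0 i j F z : alternating_at i j F ->
  z$[inl i] = z$[inl j] -> F z = 0.
Proof.
move=> Fa zij.
have := Fa z; have -> : swap_rows i j z = z.
  by apply/ffunP => d; rewrite ffunE; case: tpermP => [->|->|//].
lra.
Qed.

Definition positive_support F := forall z i, z$[inl i] <= 0 -> F z = 0.

Definition strict z :=
  (forall i : 'I_r.+1, 0 < z$[inl i]) /\
  (forall i j : 'I_r.+1, i.+1 = j -> z$[inl i] < z$[inl j]).

Lemma strict_rows z z' : (forall i, z$[inl i] = z'$[inl i]) ->
  strict z -> strict z'.
Proof. by move=> E [h1 h2]; split=> [i|i j /h2]; rewrite -!E. Qed.

(** In both exceptional cases a function with positive support and alternating rows vanishes at
    [z - 'δ (inl i)]: the first row becomes 0, or row [i] meets its predecessor. *)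
Lemma strict_step z i : strict z ->
  [\/ strict (z - 'δ (inl i)), i = ord0 /\ z$[inl i] = 1 |
      exists2 j : 'I_r.+1, j.+1 = i & z$[inl i] = z$[inl j] + 1].
Proof.
move=> [h1 h2].
have E x : (z - 'δ (inl i))$[inl x] = z$[inl x] - (if x == i then 1 else 0).
  by rewrite !entryE.
have key : (forall j : 'I_r.+1, j.+1 = i -> z$[inl j] + 1 < z$[inl i]) ->
  (0 < z$[inl i] - 1) -> strict (z - 'δ (inl i)).
  move=> H0 H1; split=> [x|x y xy]; rewrite !E.
    have [->//|_] := eqVneq x i; rewrite subr0; exact: h1.
  have := h2 _ _ xy; have [yi|_] := eqVneq y i.
    move: xy; rewrite yi => /[dup] /H0 h xi _.
    have [xi'|_] := eqVneq x i; first by rewrite xi' in xi; lia.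
    by rewrite /=; lia.
  by case: (x == i) => /=; lia.
have [i0|i0] := eqVneq i ord0.
  have [z1|z1] := eqVneq (z$[inl i]) 1; first by apply: Or32.
  apply: Or31; apply: key => [j|]; first by rewrite i0.
  by have := h1 i; lia.
have ij : (i.-1 < r.+1)%N by case: i {h1 h2 E key i0} => /=; lia.
have ij' : (Ordinal ij).+1 = i :> nat.
  by rewrite /= prednK // lt0n.
have := h2 _ _ ij'; have := h1 (Ordinal ij) => hj hji.
have [zi|zi] := eqVneq (z$[inl i]) (z$[inl (Ordinal ij)] + 1).
  by apply: Or33; exists (Ordinal ij).
apply: Or31; apply: key => [j ji|]; last by lia.
have -> : j = Ordinal ij by apply: val_inj => /=; lia.
lia.
Qed.

(* The geometric series in the shift [δ P - δ d]: on states where the letter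
   [P] has multiplicity [- z P], it inserts the letter [P] in the row [d]
   any number of times. *)
Definition series (P : 'I_m) d G z : R :=
  \sum_(k < `|z$[inr P]|.+1) G (z + ('δ (inr P) - 'δ d) *+ k).

Section Letter.

Variable P : 'I_m.

Definition letter_support G := forall z, 0 < z$[inr P] -> G z = 0.

Lemma shiftP (i : 'I_r.+1) k z :
  (z + ('δ (inr P) - 'δ (inl i)) *+ k)$[inr P] = z$[inr P] + k%:Z.
Proof. by rewrite !entryE eqxx /= subr0 -natz. Qed.

(** Beyond the multiplicity of [P] the shifted state has a positive entry at [P], where [G]
    vanishes; so the cutoff in [series] is immaterial. *)
Lemma series_bound N i G z : letter_support G -> - z$[inr P] < N%:Z ->
  series P (inl i) G z =
  \sum_(k < N) G (z + ('δ (inr P) - 'δ (inl i)) *+ k).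
Proof.
move=> Gl zN; pose g k := G (z + ('δ (inr P) - 'δ (inl i)) *+ k).
have main n1 n2 : (n1 <= n2)%N -> - z$[inr P] < n1%:Z ->
    \sum_(k < n1) g k = \sum_(k < n2) g k.
  move=> n12 zn1; rewrite -!(big_mkord predT g) /=.
  rewrite (big_cat_nat (n := n1) (p := n2)) //= [X in _ + X]big_nat_cond.
  rewrite [X in _ + X]big1 ?addr0 // => k /andP[/andP[nk _] _].
  by apply: Gl; rewrite shiftP; lia.
rewrite /series -/(g _).
have [le|/ltnW le] := leqP N `|z$[inr P]|.+1.
  by rewrite (main _ _ le).
by apply: main => //; lia.
Qed.

Lemma series_support i G : letter_support G ->
  letter_support (series P (inl i) G).
Proof.
move=> Gl z zP; rewrite (@series_bound 0) ?big_ord0 //; lia.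
Qed.

Lemma series_rec i G z : letter_support G ->
  series P (inl i) G z =
  G z + series P (inl i) G (z + ('δ (inr P) - 'δ (inl i))).
Proof.
move=> Gl; rewrite (@series_bound `|z$[inr P]|.+2) //; last by lia.
rewrite big_ord_recl mulr0n addr0; congr (_ + _).
rewrite (@series_bound `|z$[inr P]|.+1) //; last first.
  by have := shiftP i 1 z; rewrite mulr1n => ->; lia.
by apply: eq_bigr => k _; rewrite lift0 mulrS addrA.
Qed.

Lemma letter_ind i (Q : state -> Prop) : (forall z, 0 < z$[inr P] -> Q z) ->
  (forall z, z$[inr P] <= 0 -> Q (z + ('δ (inr P) - 'δ (inl i))) -> Q z) ->
  forall z, Q z.
Proof.
move=> Q0 QS z; have [n] := ubnP `|z$[inr P]|; elim: n z => // n IH z zn.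
have [/QS h|/Q0//] := lerP (z$[inr P]) 0; apply: h.
have E := shiftP i 1 z; rewrite mulr1n in E.
have [h|h] := lerP (z$[inr P]) (-1); last by apply: Q0; rewrite E; lia.
by apply: IH; rewrite E; lia.
Qed.

Lemma series_comm i j G z : letter_support G ->
  series P (inl i) (series P (inl j) G) z =
  series P (inl j) (series P (inl i) G) z.
Proof.
move=> Gl; set N := `|z$[inr P]|.+1.
have main x y : series P (inl x) (series P (inl y) G) z = \sum_(k < N)
    \sum_(k' < N) G (z + ('δ (inr P) - 'δ (inl x)) *+ k
      + ('δ (inr P) - 'δ (inl y)) *+ k').
  rewrite (@series_bound N) ?series_support //; last by rewrite /N; lia.
    by apply: eq_bigr => k _; rewrite (@series_bound N) // shiftP /N; lia.
  exact: series_support.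
rewrite !main exchange_big; apply: eq_bigr => k _; apply: eq_bigr => k' _.
by rewrite addrAC.
Qed.

Lemma eq_series d G G' : G =1 G' -> series P d G =1 series P d G'.
Proof. by move=> E z; apply: eq_bigr => k _; rewrite E. Qed.

Lemma seriesN d G z : series P d (fun z => - G z) z = - series P d G z.
Proof. by rewrite /series sumrN. Qed.

Lemma series_swap i j k G z :
  series P (inl k) G (swap_rows i j z) =
  series P (tperm (inl i) (inl j) (inl k)) (G \o swap_rows i j) z.
Proof.
rewrite /series entry_swap tpermD //; apply: eq_bigr => l _ /=.
congr (G _); rewrite swap_rowsD swap_rowsMn swap_rowsB !swap_rows_unit.
by rewrite tpermK tpermD.
Qed.

Lemma series_alternating i j k G : k != i -> k != j ->
  alternating_at i j G -> alternating_at i j (series P (inl k) G).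
Proof.
move=> ki kj Ga z; rewrite series_swap tpermD 1?eq_sym //.
by rewrite -seriesN; apply: eq_series => y /=; rewrite Ga.
Qed.

(** A series in one of the two rows destroys the antisymmetry; both together preserve it because
    they commute. *)
Lemma series2_alternating i j G : letter_support G -> alternating_at i j G ->
  alternating_at i j (series P (inl j) (series P (inl i) G)).
Proof.
move=> Gl Ga z; rewrite series_swap tpermR.
rewrite (@eq_series _ _ (fun z => - series P (inl j) G z)).
  by rewrite seriesN series_comm.
by move=> y /=; rewrite series_swap tpermL -seriesN; apply: eq_series => x /=.
Qed.

Lemma series_positive_support i G :
  positive_support G -> positive_support (series P (inl i) G).
Proof.
move=> Gp z x zx; rewrite /series big1 // => k _; apply: (Gp _ x).
by rewrite !entryE /=; case: (_ == _) => /=; lia.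
Qed.

End Letter.

End States.

Local Notation "'δ" := unit_state.
Local Notation "z $[ d ]" := (entry z d) (at level 2, format "z $[ d ]").

(** * Inserting one letter into the rows, from the shortest to the longest *)

Section Tower.

Variables (R : realFieldType) (r m : nat).
Local Notation I := ('I_r.+1 + 'I_m)%type.
Local Notation state := (state r m).
Implicit Types (F G : state -> R) (z : state) (d : I).

Lemma state_ext z z' : (forall d, z$[d] = z'$[d]) -> z = z'.
Proof. by move=> E; apply/ffunP. Qed.

(** Rows [0, ..., k-1] have received [P]. For [k = r.+1] all rows enter symmetrically: alternants
    get multiplied by complete homogeneous symmetric functions, which by Pieri's rule adds
    horizontal strips. *)
Fixpoint tower P G k : state -> R :=
  if k is k'.+1 then series P (inl (inord k')) (tower P G k') else G.

(** The swap negates the matrix [q], so its entries off [i] and [j] vanish. Row [d] being equal to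
    row [j], these zeros pass to row [j], and by the swap to row [i]. *)
Lemma alternating_entries0 (i j : 'I_r.+1) (d : I) F z : i != j ->
  d != inl i -> d != inl j -> alternating_at i j F ->
  z$[inl i] = z$[inl j] ->
  (forall x, F (z - 'δ d - 'δ x) = F (z - 'δ (inl j) - 'δ x)) ->
  forall x y, F (z - 'δ x - 'δ y) = 0.
Proof.
move=> ij di dj Fa zij Fd; pose s := tperm (inl i) (inl j : I).
pose q x y := F (z - 'δ x - 'δ y).
have qC x y : q x y = q y x by rewrite /q addrAC.
have zs : swap_rows i j z = z.
  by apply/ffunP => x; rewrite ffunE; case: tpermP => [->|->|//].
have qs x y : q (s x) (s y) = - q x y.
  rewrite /q -Fa; congr F.
  by rewrite !swap_rowsB !swap_rows_unit zs.
have qd x : q d x = q (inl j) x by exact: Fd.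
have sd x : x != inl i -> x != inl j -> s x = x.
  by move=> xi xj; rewrite /s tpermD // eq_sym.
have q0 x y : x != inl i -> x != inl j -> y != inl i -> y != inl j ->
    q x y = 0.
  by move=> *; have := qs x y; rewrite !sd //; lra.
have qj x : x != inl i -> x != inl j -> q (inl j) x = 0.
  by move=> xi xj; rewrite -qd q0.
have qi x : x != inl i -> x != inl j -> q (inl i) x = 0.
  move=> xi xj; have := qs (inl j) x.
  by rewrite /s tpermR -/s sd // qj // oppr0.
have qjj : q (inl j) (inl j) = 0 by rewrite -qd qC qj.
have qji : q (inl j) (inl i) = 0 by rewrite -qd qC qi.
have qii : q (inl i) (inl i) = 0.
  by have := qs (inl j) (inl j); rewrite /s tpermR qjj oppr0.
move=> x y; rewrite -/(q x y).
have [->|xi] := eqVneq x (inl i).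
  have [->//|yi] := eqVneq y (inl i).
  by have [->|yj] := eqVneq y (inl j); [rewrite qC | apply: qi].
have [->|xj] := eqVneq x (inl j).
  have [->//|yi] := eqVneq y (inl i).
  by have [->//|yj] := eqVneq y (inl j); apply: qj.
have [->|yi] := eqVneq y (inl i); first by rewrite qC qi.
have [->|yj] := eqVneq y (inl j); first by rewrite qC qj.
exact: q0.
Qed.

(** The swap negates the matrix of the form but fixes the vectors with equal coordinates at [i] and
    [j], so on that hyperplane the form is its own opposite. *)
Lemma alternating_lorentzian (i j : 'I_r.+1) F z : alternating_at i j F ->
  z$[inl i] = z$[inl j] -> lorentzian (hess F z).
Proof.
move=> Fa zij; exists (fun u : vect R r m => (u (inl i) : R) - u (inl j)).
  by move=> a u v; rewrite !ffunE /GRing.scale /=; ring.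
move=> u /eqP; rewrite subr_eq0 => /eqP uij.
pose s := tperm (inl i) (inl j : I).
have us d : u (s d) = u d by rewrite /s; case: tpermP => [->|->|//].
have zs : swap_rows i j z = z.
  by apply/ffunP => x; rewrite ffunE; case: tpermP => [->|->|//].
suff : hess F z u u = - hess F z u u by lra.
rewrite {1}/hess (reindex_inj (@perm_inj _ s)) /= -sumrN.
apply: eq_bigr => d _.
rewrite (reindex_inj (@perm_inj _ s)) /= -sumrN.
apply: eq_bigr => d' _; rewrite !us -mulrN -Fa.
by rewrite !swap_rowsB !swap_rows_unit zs.
Qed.

Section Step.

Variables (P : 'I_m) (G0 : state -> R) (nmax : int).

Local Notation T := (tower P G0).

Hypothesis G0l : letter_support P G0.
Hypothesis G0p : positive_support G0.
Hypothesis G0a : forall i j : 'I_r.+1, i.+1 = j -> alternating_at i j G0.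
Hypothesis G0n : forall z, strict z -> 0 <= G0 z.

Lemma tower_support k : letter_support P (T k).
Proof. by elim: k => //= k IH; apply: series_support. Qed.

Lemma tower_positive_support k : positive_support (T k).
Proof. by elim: k => //= k IH; apply: series_positive_support. Qed.

Lemma tower_rec k z :
  T k.+1 z = T k z + T k.+1 (z + ('δ (inr P) - 'δ (inl (inord k)))).
Proof. by rewrite [LHS]/= series_rec //; exact: tower_support. Qed.

(** Only the pair [i = k-1], [j = k] is excluded: there one row has received the letter and the
    other has not. *)
Lemma tower_alternating k (i j : 'I_r.+1) : (k <= r.+1)%N -> i.+1 = j ->
  (j < k)%N || (k <= i)%N -> alternating_at i j (T k).
Proof.
elim/ltn_ind: k => -[|k] IH kr ij /=; first by move=> _; apply: G0a.
have neq (x : 'I_r.+1) : (k != x)%N -> inord k != x.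
  by apply: contra => /eqP <-; rewrite inordK.
rewrite ltnS; case/orP => [|ki]; last first.
  by apply: series_alternating; [apply: neq|apply: neq|apply: IH]; lia.
rewrite leq_eqVlt => /orP[/eqP jk|jk]; last first.
  by apply: series_alternating; [apply: neq|apply: neq|apply: IH]; lia.
have -> : inord k = j by apply: val_inj; rewrite /= inordK.
rewrite -jk -ij /= inord_val.
apply: series2_alternating; first exact: tower_support.
by apply: IH; rewrite ?leqnn ?orbT //; lia.
Qed.

(** The shifted state in [tower_rec] is strict again, or positive support or antisymmetry gives 0
    there. Antisymmetry is available because row [k] and its predecessor have both received the
    letter in [T k.+1]. *)
Lemma tower_ge0 k z : (k <= r.+1)%N -> strict z -> 0 <= T k z.
Proof.
elim: k z => [|k IH] z kr; first exact: G0n.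
pose i : 'I_r.+1 := inord k; have ik : i = k :> nat by rewrite inordK.
elim/(@letter_ind _ _ P i): z => z zP.
  by move=> _; rewrite tower_support.
move=> IHz zs; rewrite tower_rec addr_ge0 ?IH //; first by lia.
rewrite -/i; case: (strict_step i zs) => [h|[i0 zi]|[j ji zi]].
- apply: IHz; apply: strict_rows h => x; rewrite !entryE /=; lia.
- by rewrite (@tower_positive_support k.+1 _ i) // !entryE !eqxx zi.
- rewrite (alternating_eq0 (i := j) (j := i)) //.
    by apply: tower_alternating => //; lia.
  rewrite !entryE !eqxx zi /=.
  have -> : (j == i) = false by apply/negbTE/eqP => E; rewrite E in ji; lia.
  lia.
Qed.

Lemma tower_next_ge0 (i : 'I_r.+1) z : strict z ->
  0 <= T i.+1 (z + ('δ (inr P) - 'δ (inl i))).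
Proof.
move=> zs; case: (strict_step i zs) => [h|[i0 zi]|[j ji zi]].
- by apply: tower_ge0 => //; apply: strict_rows h => x; rewrite !entryE /=; lia.
- by rewrite (@tower_positive_support i.+1 _ i) // !entryE !eqxx zi.
- rewrite (alternating_eq0 (i := j) (j := i)) //.
    by apply: tower_alternating => //; lia.
  rewrite !entryE !eqxx zi /=.
  have -> : (j == i) = false by apply/negbTE/eqP => E; rewrite E in ji; lia.
  lia.
Qed.

Lemma tower_le k1 k2 z : (k1 <= k2)%N -> (k2 <= r.+1)%N -> strict z ->
  T k1 z <= T k2 z.
Proof.
move=> k12 + zs; rewrite -(subnKC k12); elim: (k2 - k1)%N => [|n IH] nr.
  by rewrite addn0.
apply: le_trans (IH _) _; first by lia.
rewrite addnS tower_rec lerDl.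
have := tower_next_ge0 (inord (k1 + n)) zs; rewrite inordK //; lia.
Qed.

Lemma tower_at0 k z : z$[inr P] = 0 -> T k z = G0 z.
Proof.
move=> z0; elim: k => // k IH; rewrite tower_rec IH tower_support ?addr0 //.
by rewrite !entryE !eqxx /= z0.
Qed.

Lemma tower_invariant (S : state -> Prop) :
  (forall i z, S (z + ('δ (inr P) - 'δ (inl i))) -> S z) ->
  (forall z, G0 z != 0 -> S z) -> forall k z, T k z != 0 -> S z.
Proof.
move=> SS S0; elim=> [|k IH] //; set i : 'I_r.+1 := inord k.
apply: (@letter_ind _ _ P i) => z zP.
  by rewrite tower_support ?eqxx.
move=> IHz; rewrite tower_rec -/i => h.
have [E|/IHz/SS//] := eqVneq (T k.+1 (z + ('δ (inr P) - 'δ (inl i)))) 0.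
by apply: IH; rewrite E addr0 in h.
Qed.

(** The shifted state has entry 1 at [P], so only row and column [P] can survive. Off the diagonal
    these are values of the vanishing linear form, since all towers agree where [P] does not occur;
    the diagonal entry reduces to this by one step of the recursion. *)
Lemma tower_connected0 (i : 'I_r.+1) z : z$[inr P] = 0 ->
  (forall d, T i (z - 'δ (inl i) - 'δ d) = 0) ->
  forall x y, T i.+1 (z + ('δ (inr P) - 'δ (inl i)) - 'δ x - 'δ y) = 0.
Proof.
move=> z0 ell0; set z' := z + _.
have lt0 k (x y : I) : x != inr P -> y != inr P -> T k (z' - 'δ x - 'δ y) = 0.
  move=> xP yP; apply: tower_support.
  rewrite /z' !entryE (eq_sym _ x) (eq_sym _ y) (negPf xP) (negPf yP) !eqxx z0.
  by [].
have eq0 x : x != inr P -> T i.+1 (z' - 'δ (inr P) - 'δ x) = 0.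
  move=> xP; have -> : z' - 'δ (inr P) - 'δ x = z - 'δ (inl i) - 'δ x.
    by apply: state_ext => y; rewrite /z' !(entryD, entryN); lia.
  rewrite -(ell0 x) !tower_at0 // !entryE (eq_sym _ x) (negPf xP) /= z0; lia.
move=> x y.
have [->|xP] := eqVneq x (inr P); have [->|yP] := eqVneq y (inr P).
- have -> : z' - 'δ (inr P) - 'δ (inr P) = z - 'δ (inl i) - 'δ (inr P).
    by apply: state_ext => d; rewrite /z' !(entryD, entryN); lia.
  rewrite tower_rec ell0 add0r inord_val.
  rewrite -[RHS](eq0 (inl i)) //; congr (T _ _).
  by apply: state_ext => d; rewrite /z' !(entryD, entryN); lia.
- exact: eq0.
- by rewrite addrAC eq0.
- exact: lt0.
Qed.

Definition other_letters z := forall q, q != P -> z$[inr q] <= 0.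

Hypothesis G0L : forall z, strict z -> other_letters z -> - nmax <= z$[inr P] ->
  lorentzian (hess G0 z).

Hypothesis connected : forall (i : 'I_r.+1) z, strict z ->
  strict (z - 'δ (inl i)) -> other_letters z -> - nmax <= z$[inr P] ->
  z$[inr P] < 0 ->
  [\/ exists d, T i (z - 'δ (inl i) - 'δ d) != 0,
      forall x y, T i (z - 'δ x - 'δ y) = 0 |
      forall x y,
        T i.+1 (z + ('δ (inr P) - 'δ (inl i)) - 'δ x - 'δ y) = 0].

Lemma hess_tower k z u v :
  hess (T k.+1) z u v = hess (T k) z u v +
    hess (T k.+1) (z + ('δ (inr P) - 'δ (inl (inord k)))) u v.
Proof.
rewrite /hess -big_split /=; apply: eq_bigr => x _.
rewrite -big_split /=; apply: eq_bigr => y _; rewrite -mulrDr.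
by congr (_ * _); rewrite -/(T k.+1) tower_rec; congr (_ + T k.+1 _);
  apply: state_ext => d; rewrite !(entryD, entryN); lia.
Qed.

(** With [C] the form of [T k] at [z] and [Q] that of [T k.+1] at [z'], the vectors [t = e_i] and
    [s = e_P - e_i] satisfy [C t = Q s]. Induction covers [Q] when [z'] is strict; when row [i]
    meets its predecessor, [z'] lies on a wall and [alternating_lorentzian] applies. *)
Lemma tower_lorentzian k z : (k <= r.+1)%N -> strict z -> other_letters z ->
  - nmax <= z$[inr P] -> lorentzian (hess (T k) z).
Proof.
elim: k z => [|k IH] z kr; first exact: G0L.
pose i : 'I_r.+1 := inord k; have ik : i = k :> nat by rewrite inordK.
have Tp := @tower_positive_support k.+1.
have Ta (j j' : 'I_r.+1) : (j' <= i)%N -> j.+1 = j' :> nat -> alternating_at j j' (T k.+1).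
  by move=> *; apply: tower_alternating => //; lia.
elim/(@letter_ind _ _ P i): z => z zP.
  move=> zs zo zn; apply: (@hess_lorentzian_at _ _ _ (inr P)) => x y xP yP.
  rewrite tower_support // !entryE (eq_sym _ x) (eq_sym _ y).
  by rewrite (negPf xP) (negPf yP); lia.
set z' := z + _ => IHz zs zo zn.
have LC : lorentzian (hess (T k) z) by apply: IH => //; lia.
have Cb := hess_bilinear (T k) z; have Qb := hess_bilinear (T k.+1) z'.
have HE u : hess (T k.+1) z u u = hess (T k) z u u + hess (T k.+1) z' u u.
  exact: hess_tower.
pose w := z - 'δ (inl i).
have ell d : T k (w - 'δ d) =
    T k.+1 (z' - 'δ (inr P) - 'δ d) - T k.+1 (z' - 'δ (inl i) - 'δ d).
  have -> : z' - 'δ (inr P) - 'δ d = w - 'δ d.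
    by apply: state_ext => x; rewrite /z' /w !(entryD, entryN); lia.
  have -> : z' - 'δ (inl i) - 'δ d =
      w - 'δ d + ('δ (inr P) - 'δ (inl (inord k))).
    rewrite -/i; by apply: state_ext => x; rewrite /z' /w !(entryD, entryN); lia.
  by rewrite tower_rec addrK.
have Q0 : (forall x y, T k.+1 (z' - 'δ x - 'δ y) = 0) ->
    lorentzian (hess (T k.+1) z).
  move=> h; apply: lorentzian_le LC _ => u; rewrite HE gerDl.
  by rewrite /hess big1 // => x _; rewrite big1 // => y _; rewrite h mulr0.
have C0 : lorentzian (hess (T k.+1) z') ->
    (forall x y, T k (z - 'δ x - 'δ y) = 0) -> lorentzian (hess (T k.+1) z).
  move=> LQ h; apply: lorentzian_le LQ _ => u; rewrite HE gerDr.
  by rewrite /hess big1 // => x _; rewrite big1 // => y _; rewrite h mulr0.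
have glue d : lorentzian (hess (T k.+1) z') -> T k (w - 'δ d) != 0 ->
    0 <= T k (w - 'δ (inr P)) -> lorentzian (hess (T k.+1) z).
  move=> LQ d0 b0.
  pose t : vect R r m := unit_vect R (inl i).
  pose s : vect R r m := -1 *: t + unit_vect R (inr P).
  have CQ v : hess (T k) z t v = hess (T k.+1) z' s v.
    rewrite (proj2 Qb) !hess_unitl mulN1r [RHS]addrC -sumrB.
    by apply: eq_bigr => x _; rewrite -mulrBr -ell.
  have Lg := lorentzian_glue Cb Qb LC LQ CQ (v0 := unit_vect R d).
  have [||l ll ln] := Lg.
  - by rewrite hess_unit.
  (* Since [Q s s = C t s] and [s = e_P - t], the sum is [C t e_P]. *)
  - rewrite -CQ (proj1 Cb t s) (proj2 Cb) mulN1r addNKr.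
    by rewrite (proj1 Cb) hess_unit.
  by exists l => // u /ln; rewrite HE.
have oP x : x != P -> z'$[inr x] = z$[inr x].
  by move=> xP; rewrite /z' !entryE (negPf xP) /=; lia.
have zP' : z'$[inr P] = z$[inr P] + 1 by rewrite /z' !entryE !eqxx /=; lia.
case: (strict_step i zs) => [h|[i0 zi]|[j ji zi]].
- have LQ : lorentzian (hess (T k.+1) z').
    apply: IHz; last by rewrite zP'; lia.
      by apply: strict_rows h => x; rewrite /z' !entryE /=; lia.
    by move=> q qP; rewrite oP // zo.
  have : [\/ exists d, T k (w - 'δ d) != 0,
      forall x y, T k (z - 'δ x - 'δ y) = 0 |
      forall x y, T k.+1 (z' - 'δ x - 'δ y) = 0].
    move: zP; rewrite le_eqVlt => /orP[/eqP z0|zP]; last first.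
      by have := connected zs h zo zn zP; rewrite -/w ik.
    have [/forallP h0|] := boolP [forall d, T k (w - 'δ d) == 0]; last first.
      by rewrite negb_forall => /existsP[d d0]; apply: Or31; exists d.
    apply: Or33; rewrite -{1}ik /z'; apply: tower_connected0 => // d.
    by rewrite ik; apply/eqP/h0.
  case=> [[d d0]|h0|h0]; last exact: Q0; last exact: C0.
  apply: glue LQ d0 _; apply: tower_ge0; first by lia.
  by apply: strict_rows h => x; rewrite !entryE /=; lia.
- apply: Q0 => x y; apply: (Tp _ i); rewrite /z' !entryE !eqxx zi.
  by rewrite /=; case: ifP => _; case: ifP => _; lia.
have ij : i != j by apply/eqP => E; rewrite E in ji; lia.
have aij := Ta _ _ (leqnn i) ji.
have zij : z'$[inl j] = z'$[inl i].
  by rewrite /z' !entryE !eqxx (eq_sym j) (negPf ij) zi /=; lia.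
have LQ := alternating_lorentzian aij zij.
(* If the common form vanishes, rows [inr P] and [inl i] of [Q] agree, which on the wall makes [Q]
   zero. *)
have [/forallP h0|] := boolP [forall d, T k (w - 'δ d) == 0].
  apply: Q0; apply: (alternating_entries0 (d := inr P) _ _ _ aij zij) => //.
    by rewrite eq_sym.
  by move=> x; have := ell x; rewrite (eqP (h0 x)); lra.
rewrite negb_forall => /existsP[d d0]; apply: glue LQ d0 _.
(* On the wall the first term of [ell] vanishes, and the swap absorbs the sign of the second. *)
have -> : T k (w - 'δ (inr P)) = T k.+1 (z - 'δ (inl j) - 'δ (inl i)).
  rewrite ell (alternating_eq0 (z := _ - _ - _) aij); last first.
    by rewrite /z' !entryE !eqxx (eq_sym j) (negPf ij) zi /=; lia.
  rewrite sub0r -aij; congr (T k.+1 _); apply: state_ext => x.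
  rewrite entry_swap; have [x1|x1] := eqVneq x (inl j).
    rewrite x1 tpermL /z' !entryE !eqxx (eq_sym j) (negPf ij) zi /=; lia.
  have [x2|x2] := eqVneq x (inl i).
    rewrite x2 tpermR /z' !entryE !eqxx (eq_sym j) (negPf ij) zi /=; lia.
  rewrite tpermD 1?eq_sym // /z' !(entryD, entryN) ![('δ (inl _))$[x]]entry_unit.
  by rewrite (negPf x1) (negPf x2); lia.
case: (strict_step j zs) => [h|[j0 zj]|[l lj zj]].
- apply: tower_ge0 => //; case: (strict_step i h) => [//|[i0]|[j' ji']].
    by rewrite i0 in ji.
  have -> : j' = j by apply: val_inj => /=; lia.
  by rewrite !entryE !eqxx (negPf ij) zi; lia.
- rewrite (Tp _ j) // !entryE !eqxx (eq_sym j) (negPf ij) zj /=; lia.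
have lj' : (l == j) = false by apply/negbTE/eqP => E; rewrite E in lj; lia.
have li' : (l == i) = false by apply/negbTE/eqP => E; rewrite E in lj; lia.
rewrite (alternating_eq0 (Ta _ _ _ lj)) //; first by lia.
by rewrite !entryE !eqxx lj' li' (eq_sym j) (negPf ij) zj /=; lia.
Qed.

End Step.
End Tower.

(** * Families of weight functions *)

Section Families.

Variables (R : realFieldType) (r m : nat).
Local Notation I := ('I_r.+1 + 'I_m)%type.
Local Notation state := (state r m).
Local Notation vect := (vect R r m).
Implicit Types (F G H : state -> R) (z w : state) (d : I).

Lemma linear_form_sum (V : lmodType R) (J : finType) (l : V -> R) (a : J -> R)
    (e : J -> V) :
  linear_form l -> l (\sum_x a x *: e x) = \sum_x a x * l (e x).
Proof.
move=> ll; have l0 : l 0 = 0 by have := ll (-1) 0 0; rewrite scaler0 addr0; lra.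
have ls : {morph l : x y / x + y}.
  by move=> x y; have := ll 1 x y; rewrite scale1r mul1r.
rewrite (big_morph l ls l0); apply: eq_bigr => x _.
by have := ll (a x) (e x) 0; rewrite !addr0 l0 addr0.
Qed.

Lemma lorentzian_pullback (e : I -> vect) c H w G z : 0 <= c ->
  (forall x y, G (z - 'δ x - 'δ y) = c * hess H w (e x) (e y)) ->
  lorentzian (hess H w) -> lorentzian (hess G z).
Proof.
move=> c0 GE [l ll ln].
pose p (u : vect) : vect := \sum_x (u x : R) *: e x.
have pl a u v : p (a *: u + v) = a *: p u + p v.
  rewrite /p scaler_sumr -big_split /=; apply: eq_bigr => x _.
  by rewrite !ffunE scalerDl scalerA.
have Hb := hess_bilinear H w.
have GE' u : hess G z u u = c * hess H w (p u) (p u).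
  have pE y : hess H w (p u) y = \sum_x (u x : R) * hess H w (e x) y.
    exact: (linear_form_sum _ _ (proj2 Hb y)).
  rewrite pE mulr_sumr; apply: eq_bigr => x _.
  rewrite (proj1 Hb) pE !mulr_sumr; apply: eq_bigr => y _.
  by rewrite GE (proj1 Hb (e y)); ring.
exists (fun u => l (p u)) => [a u v|u /ln le0]; first by rewrite pl ll.
by rewrite GE' mulr_ge0_le0.
Qed.

(** Up to the constant [min_row_sum] due to the shift of the rows, this is the number of boxes minus
    the number of letters; inserting a letter preserves it. *)
Definition entry_sum z : int := \sum_d z$[d].
Definition row_sum z : int := \sum_(i : 'I_r.+1) z$[inl i].
Definition min_row_sum : int := \sum_(i < r.+1) i.+1%:Z.

Lemma entry_sumE z : entry_sum z = row_sum z + \sum_(q < m) z$[inr q].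
Proof. by rewrite /entry_sum big_sumType. Qed.

Lemma entry_sumB z d : entry_sum (z - 'δ d) = entry_sum z - 1.
Proof.
rewrite /entry_sum (bigD1 d) //= (bigD1 (P := predT) d) //= !entryE eqxx.
rewrite (eq_bigr (fun x => z$[x])); first by ring.
by move=> x xd; rewrite !entryE (negPf xd) subr0.
Qed.

Lemma entry_sumD z d : entry_sum (z + 'δ d) = entry_sum z + 1.
Proof. by have := entry_sumB (z + 'δ d) d; rewrite addrK; lia. Qed.

Lemma entry_sum_shift z d d' : entry_sum (z + ('δ d - 'δ d')) = entry_sum z.
Proof. by rewrite addrA entry_sumB entry_sumD addrK. Qed.

Lemma row_sum_ge z : (forall q, z$[inr q] <= 0) -> entry_sum z <= row_sum z.
Proof. by move=> h; rewrite entry_sumE gerDl sumr_le0. Qed.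

Lemma corner_or_minimal z k : strict z -> (k <= r.+1)%N ->
  (exists2 i : 'I_r.+1, (i < k)%N & strict (z - 'δ (inl i))) \/
  (forall i : 'I_r.+1, (i < k)%N -> z$[inl i] = i.+1%:Z).
Proof.
move=> zs; elim: k => [|k IH] kr; first by right.
have [[i ik h]|h] := IH (ltnW kr); first by left; exists i => //; lia.
pose j : 'I_r.+1 := Ordinal kr.
have zj : strict (z - 'δ (inl j)) \/ z$[inl j] = j.+1%:Z.
  case: (strict_step j zs) => [|[j0 ->]|[l lj ->]]; first by left.
    by right; rewrite j0.
  by have {}lj : l.+1 = k := lj; right; rewrite h /=; lia.
case: zj => [zj|zj]; first by left; exists j => /=.
right=> i; rewrite ltnS leq_eqVlt => /orP[/eqP ik|/h//].
by have -> : i = j by apply: val_inj.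
Qed.

Lemma corner z : strict z -> min_row_sum < row_sum z ->
  exists i : 'I_r.+1, strict (z - 'δ (inl i)).
Proof.
move=> zs; have [[i _ h]|h] := corner_or_minimal zs (leqnn _).
  by exists i.
by rewrite /row_sum (eq_bigr _ (fun i _ => h i (ltn_ord i))) ltxx.
Qed.

(* [F] is (a perturbation of) the weight multiplicity function of the tableaux
   in the first [p] letters. *)
Record weight_family (N : int) (p : nat) F : Prop := Family {
  family_pos : positive_support F;
  family_alt : forall i j : 'I_r.+1, i.+1 = j -> alternating_at i j F;
  family_supp : forall z, F z != 0 -> [/\ entry_sum z = N,
    forall q : 'I_m, z$[inr q] <= 0 &
    forall q : 'I_m, (p <= q)%N -> z$[inr q] = 0];
  family_gt0 : forall z, strict z -> entry_sum z = N ->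
    (forall q : 'I_m, z$[inr q] <= 0) ->
    (forall q : 'I_m, (p <= q)%N -> z$[inr q] = 0) -> 0 < F z;
  family_lorentzian : forall z, strict z -> lorentzian (hess F z) }.

Lemma family_ge0 N p F z : weight_family N p F -> strict z -> 0 <= F z.
Proof.
move=> fF zs; have [->//|/(family_supp fF)[h1 h2 h3]] := eqVneq (F z) 0.
by apply: ltW; apply: (family_gt0 fF).
Qed.

Lemma equal_rows0 F (i j : 'I_r.+1) z :
  (forall i j : 'I_r.+1, i.+1 = j -> alternating_at i j F) ->
  (i < j)%N -> z$[inl i] = z$[inl j] -> F z = 0.
Proof.
move=> Fa; have [n] := ubnP j; elim: n j z => // n IH j z jn ij zij.
have jr : (j.-1 < r.+1)%N by have := ltn_ord j; lia.
pose k : 'I_r.+1 := Ordinal jr.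
have kj : k.+1 = j by rewrite /= prednK //; lia.
have [ik|ik] := eqVneq i k.
  by apply: (alternating_eq0 (Fa _ _ kj)); rewrite -ik.
suff : F (swap_rows k j z) = 0 by rewrite Fa //; lra.
have ik' : (i < k)%N.
  by rewrite ltn_neqAle -(inj_eq val_inj) in ik *; rewrite ik /=; lia.
apply: (IH k) => //; first by move: kj jn; lia.
rewrite !entry_swap tpermL tpermD //.
  by apply/eqP => -[E]; rewrite E ltnn in ik'.
by apply/eqP => -[E]; rewrite E ltnn in ij.
Qed.

(** Where [F] does not vanish the rows are positive and pairwise distinct, so the bounds [1, 2, ...]
    determine them one after another. *)
Lemma small_rows0 F k z : positive_support F ->
  (forall i j : 'I_r.+1, i.+1 = j -> alternating_at i j F) ->
  (k <= r.+1)%N -> (forall l : 'I_r.+1, (l < k)%N -> z$[inl l] <= l.+1%:Z) ->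
  F z != 0 -> forall l : 'I_r.+1, (l < k)%N -> z$[inl l] = l.+1%:Z.
Proof.
move=> Fp Fa; elim: k => // k IH kr zl Fz l; rewrite ltnS leq_eqVlt.
have {}IH : forall l : 'I_r.+1, (l < k)%N -> z$[inl l] = l.+1%:Z.
  by apply: IH => // [|x xk]; [lia|apply: zl; lia].
case/orP => [/eqP lk|/IH//]; apply/eqP; rewrite eq_le zl ?lk //=.
rewrite leNgt; apply: contra Fz => zlk; apply/eqP.
have [/Fp//|z0] := lerP z$[inl l] 0.
have jr : (`|z$[inl l]|.-1 < r.+1)%N by lia.
apply: (@equal_rows0 F (Ordinal jr) l) => //=; first by lia.
by rewrite IH /=; lia.
Qed.

(** Multiplication of alternants by the first complete symmetric function: the new box carries no
    letter. *)
Definition add_box F z := \sum_(i : 'I_r.+1) F (z - 'δ (inl i)).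

Lemma add_box_pos F : positive_support F -> positive_support (add_box F).
Proof.
move=> Fp z i zi; rewrite /add_box big1 // => j _; apply: (Fp _ i).
by rewrite !entryE; case: ifP => _; lia.
Qed.

Lemma add_box_alt F i j : alternating_at i j F -> alternating_at i j (add_box F).
Proof.
move=> Fa z; rewrite /add_box (reindex_inj (@perm_inj _ (tperm i j))) -sumrN.
apply: eq_bigr => k _; rewrite -Fa swap_rowsB swap_rows_unit.
by congr (F (_ - 'δ _)); rewrite -(inj_tperm _ _ _ inl_inj).
Qed.

End Families.

(** * Adding a free box *)

Section AddLetter.

Variables (R : realFieldType) (r m : nat).
Local Notation I := ('I_r.+1 + 'I_m)%type.
Local Notation state := (state r m).
Local Notation vect := (vect R r m).
Implicit Types (F G H : state -> R) (z w : state) (d : I).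

Lemma family_step_ge0 N p F z (i : 'I_r.+1) : weight_family N p F -> strict z ->
  0 <= F (z - 'δ (inl i)).
Proof.
move=> fF zs; case: (strict_step i zs) => [h|[i0 zi]|[j ji zi]].
- exact: family_ge0 fF h.
- by rewrite (@family_pos _ _ _ _ _ _ fF _ i) // !entryE eqxx zi.
rewrite (alternating_eq0 (family_alt fF ji)) // !entryE eqxx zi.
have -> : (j == i) = false by apply/negbTE/eqP => E; rewrite E in ji; lia.
lia.
Qed.

Lemma add_box_ge0 N p F z : weight_family N p F -> strict z -> 0 <= add_box F z.
Proof. by move=> fF zs; apply: sumr_ge0 => i _; apply: family_step_ge0 fF zs. Qed.

Lemma add_box_gt0 N p F z : min_row_sum r <= N -> weight_family N p F -> strict z ->
  entry_sum z = N + 1 -> (forall q : 'I_m, z$[inr q] <= 0) ->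
  (forall q : 'I_m, (p <= q)%N -> z$[inr q] = 0) -> 0 < add_box F z.
Proof.
move=> NN fF zs zN z0 zp.
have [|i zi] := corner zs; first by have := row_sum_ge z0; lia.
rewrite /add_box (bigD1 i) //= ltr_pwDl //; last first.
  by apply: sumr_ge0 => j _; apply: family_step_ge0 fF zs.
have zE (q : 'I_m) : (z - 'δ (inl i))$[inr q] = z$[inr q].
  by rewrite !entryE /= subr0.
apply: (family_gt0 fF) => // [|q|q qp]; rewrite ?zE //; last exact: zp.
by rewrite entry_sumB; lia.
Qed.

Lemma add_box_supp N p F z : weight_family N p F -> add_box F z != 0 ->
  [/\ entry_sum z = N + 1, forall q : 'I_m, z$[inr q] <= 0 &
    forall q : 'I_m, (p <= q)%N -> z$[inr q] = 0].
Proof.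
move=> fF h.
have /existsP[i /(family_supp fF)[h1 h2 h3]] :
    [exists i : 'I_r.+1, F (z - 'δ (inl i)) != 0].
  apply: contraNT h; rewrite negb_exists => /forallP h.
  by rewrite /add_box big1 // => i _; apply/eqP; have := h i; rewrite negbK.
have zE (q : 'I_m) : (z - 'δ (inl i))$[inr q] = z$[inr q].
  by rewrite !entryE /= subr0.
split=> [|q|q /h3]; rewrite -?zE //.
by rewrite entry_sumB in h1; lia.
Qed.

(** Unit vectors other than that of [q] leave the forbidden entry at [q] in place, so the matrix
    lives in row and column [q]. *)
Lemma letter_lorentzian N p F (q : 'I_m) z :
  (forall z, F z != 0 -> [/\ entry_sum z = N, forall q : 'I_m, z$[inr q] <= 0 &
    forall q : 'I_m, (p <= q)%N -> z$[inr q] = 0]) ->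
  0 < z$[inr q] \/ (p <= q)%N /\ z$[inr q] != 0 -> lorentzian (hess F z).
Proof.
move=> Fs zq; apply: (hess_lorentzian_at (d := inr q)) => x y xq yq.
apply/eqP; case: eqP => // /eqP /Fs[_ h1 h2]; move: (h1 q) (h2 q).
rewrite !entryE (eq_sym _ x) (eq_sym _ y) (negPf xq) (negPf yq) !subr0.
case: zq => [|[pq /eqP h]]; first by lia.
by move=> _ /(_ pq).
Qed.

Section AddBox.

Variables (N : int) (P : 'I_m) (F : state -> R).
Hypothesis NN : min_row_sum r <= N.
Hypothesis fF : weight_family N P F.
Local Notation T := (tower P F).

Let F0 z : z$[inr P] != 0 -> F z = 0.
Proof.
by move=> zP; apply/eqP; apply: contraNT zP => /(family_supp fF)[_ _ ->].
Qed.

Let Fl : letter_support P F.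
Proof. by move=> z zP; apply: F0; rewrite gt_eqF. Qed.

(** [P] does not occur in [F], so its one occurrence goes to one of the first [k] rows; with all
    rows this is a free box. *)
Let tower1 k z : z$[inr P] = -1 ->
  T k z = \sum_(i < k) F (z + ('δ (inr P) - 'δ (inl (inord i)))).
Proof.
move=> zP; elim: k => [|k IH]; first by rewrite big_ord0 /= F0 // zP.
rewrite tower_rec // IH big_ord_recr; congr (_ + _).
by rewrite tower_at0 // !entryE eqxx zP.
Qed.

Let tower_small k z : (k <= r.+1)%N -> z$[inr P] < 0 ->
  (forall l : 'I_r.+1, (l < k)%N -> z$[inl l] <= l.+1%:Z) -> T k z = 0.
Proof.
elim: k z => [|k IH] z kr zP; first by move=> _; apply: F0; rewrite lt_eqF.
pose i : 'I_r.+1 := inord k; have ik : i = k :> nat by rewrite inordK.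
elim/(@letter_ind _ _ P i): z zP => z zP; first by lia.
set z' := z + _ => IHz zP0 zl.
have zP' : z'$[inr P] = z$[inr P] + 1 by rewrite /z' !entryE eqxx /= subr0.
have zE l : z'$[inl l] = z$[inl l] - (if l == i then 1 else 0).
  by rewrite /z' !entryE /= sub0r.
rewrite tower_rec // IH ?add0r //; [|by lia|by move=> l lk; apply: zl; lia].
have zl' (l : 'I_r.+1) : (l < k.+1)%N -> z'$[inl l] <= l.+1%:Z.
  by move=> /zl; rewrite zE; case: ifP => _; lia.
have [z1|z1] := ltrP z'$[inr P] 0; first exact: IHz.
rewrite -/i -/z' tower_at0 //; last by lia.
apply/eqP; apply/negPn/negP => Fz.
have := small_rows0 (family_pos fF) (family_alt fF) kr zl' Fz (l := i).
have := zl i; rewrite zE eqxx ik; lia.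
Qed.

(** If the rows before [i] are minimal, they have no room for [P] and the first form is zero;
    likewise if [z] does not match the support of [F]. Otherwise a removable box in a row [l < i]
    makes the linear form nonzero. *)
Let connected1 (i : 'I_r.+1) z : strict z -> strict (z - 'δ (inl i)) ->
  other_letters P z -> - 1 <= z$[inr P] -> z$[inr P] < 0 ->
  [\/ exists d, T i (z - 'δ (inl i) - 'δ d) != 0,
      forall x y, T i (z - 'δ x - 'δ y) = 0 |
      forall x y,
        T i.+1 (z + ('δ (inr P) - 'δ (inl i)) - 'δ x - 'δ y) = 0].
Proof.
move=> zs zis zo zn zP; have {zn} zP1 : z$[inr P] = -1 by lia.
have [[l li zl]|zl] := corner_or_minimal zs (ltnW (ltn_ord i)); last first.
  apply: Or32 => x y; apply: tower_small; first exact: ltnW.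
    by rewrite !entryE; do 2!case: ifP => _; lia.
  by move=> l /zl <-; rewrite !entryE; do 2!case: ifP => _; lia.
have Tinv (S : state -> Prop) : (forall i z, S (z + ('δ (inr P) - 'δ (inl i)))
    -> S z) -> (forall z, F z != 0 -> S z) -> forall k z, T k z != 0 -> S z.
  exact: tower_invariant.
have [zN|zN] := eqVneq (entry_sum z) (N + 2); last first.
  apply: Or32 => x y; apply/eqP; apply: contraNT zN => h.
  have := Tinv (fun z => entry_sum z = N) _ _ _ _ h.
  rewrite !entry_sumB => E; apply/eqP.
  suff : entry_sum z - 1 - 1 = N by lia.
  by apply: E => [j t|t /(family_supp fF)[]//]; rewrite entry_sum_shift.
have [/forallP zq|] := boolP [forall q : 'I_m, (P < q)%N ==> (z$[inr q] == 0)];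
    last first.
  rewrite negb_forall => zq.
  have {zq} [q Pq zq] : exists2 q : 'I_m, (P < q)%N & z$[inr q] != 0.
    by case/existsP: zq => q; rewrite negb_imply => /andP[]; exists q.
  have qP : q != P by apply: contraTneq Pq => ->; rewrite ltnn.
  apply: Or32 => x y; apply/eqP; apply: contraNT zq => h.
  have := Tinv (fun z => z$[inr q] = 0) _ _ _ _ h.
  rewrite !entryE; move=> E; apply/eqP; have zq : z$[inr q] <= 0 by apply: zo.
  have : z$[inr q] - (if inr q == x then 1 else 0)
                   - (if inr q == y then 1 else 0) = 0.
    apply: E => [j t|t /(family_supp fF)[_ _ h3]]; last by apply: h3; lia.
    by rewrite !entryE (negPf qP) /=; lia.
  by do 2!case: ifP => _; lia.
set w := z - 'δ (inl i).
(* Exchanging the two sums turns this into values of [add_box F]; since that function is alternating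
   they are all nonnegative, and the one for row [l] is positive. *)
suff : \sum_(d : 'I_r.+1) T i (w - 'δ (inl d)) != 0.
  move=> h; apply: Or31; have /existsP[d hd] :
      [exists d : 'I_r.+1, T i (w - 'δ (inl d)) != 0].
    apply: contraNT h; rewrite negb_exists => /forallP h.
    by rewrite big1 // => d _; apply/eqP; have := h d; rewrite negbK.
  by exists (inl d).
have wP : w$[inr P] = -1 by rewrite /w !entryE /= zP1.
pose y k := w + ('δ (inr P) - 'δ (inl k)).
have yE (k : 'I_r.+1) : y k = w - 'δ (inl k) + 'δ (inr P).
  by apply: state_ext => d; rewrite /y !(entryD, entryN); lia.
have -> : \sum_(d : 'I_r.+1) T i (w - 'δ (inl d)) =
    \sum_(k < i) add_box F (y (inord k)).
  rewrite /add_box exchange_big /=; apply: eq_bigr => d _.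
  rewrite tower1; last by rewrite /w !entryE /= zP1.
  apply: eq_bigr => k _; congr F; apply: state_ext => x.
  by rewrite /y !(entryD, entryN); lia.
have strict_P t : strict t -> strict (t + 'δ (inr P)).
  by apply: strict_rows => k; rewrite !entryE /=; lia.
have li' : (l == i) = false by apply/negbTE/eqP => E; rewrite E ltnn in li.
have y0 (k : 'I_r.+1) : 0 <= add_box F (y k).
  case: (strict_step k zis) => [h|[k0 zk]|[j jk zk]].
  - by apply: (add_box_ge0 fF); rewrite yE; apply: strict_P.
  - rewrite (add_box_pos (family_pos fF) (i := k)) //.
    by rewrite /y /w !entryE !eqxx /= in zk *; lia.
  - rewrite (alternating_eq0 (add_box_alt (family_alt fF jk))) //.
    have jk' : (j == k) = false.
      by apply/negbTE/eqP => E; rewrite E in jk; lia.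
    by rewrite /y /w !entryE !eqxx jk' /= in zk *; lia.
have yl : 0 < add_box F (y l).
  have wl : strict (w - 'δ (inl l)).
    case: (strict_step l zis) => [//|[l0 wl]|[j jl wl]].
      have := proj1 zl l; move: wl.
      by rewrite /w !entryE eqxx li'; lia.
    have ji : (j == i) = false by apply/negbTE/eqP => E; rewrite E in jl; lia.
    have jl' : (j == l) = false by apply/negbTE/eqP => E; rewrite E in jl; lia.
    have := proj2 zl _ _ jl; move: wl.
    by rewrite /w !entryE eqxx ji jl' li'; lia.
  apply: (add_box_gt0 NN fF).
  - by rewrite yE; apply: strict_P.
  - by rewrite /y entry_sum_shift /w entry_sumB zN; lia.
  - move=> q; rewrite /y /w !entryE /=.
    have [->|qP] := eqVneq q P; first by rewrite zP1.
    by rewrite !subr0; apply: zo.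
  - move=> q; rewrite leq_eqVlt => /orP[/eqP/val_inj <-|Pq].
      by rewrite /y /w !entryE eqxx zP1.
    have qP : (q == P) = false by apply/eqP => E; rewrite E ltnn in Pq.
    by have := zq q; rewrite Pq /= => /eqP zq0; rewrite /y /w !entryE zq0 qP.
rewrite gt_eqF // (bigD1 (Ordinal li)) //= ltr_pwDl //.
  by rewrite inord_val.
exact: sumr_ge0.
Qed.

(** If [P] is absent from [z], the form of [add_box F] at [z] is that of the full tower at
    [z - 'δ (inr P)], pulled back along the map killing the coordinate [P]. *)
Lemma add_box_family : weight_family (N + 1) P (add_box F).
Proof.
have Fs := @add_box_supp N P F _ fF.
split.
- exact: add_box_pos (family_pos fF).
- by move=> i j ij; apply/add_box_alt/(family_alt fF).
- by move=> z; apply: Fs.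
- by move=> z *; apply: (add_box_gt0 NN fF).
move=> z zs; have [zP|zP] := eqVneq z$[inr P] 0; last first.
  by apply: (letter_lorentzian (q := P) Fs); right.
have [/forallP zo|] := boolP [forall q : 'I_m, z$[inr q] <= 0]; last first.
  rewrite negb_forall => /existsP[q]; rewrite -ltNge => zq.
  by apply: (letter_lorentzian (q := q) Fs); left.
pose e x : vect := if x == inr P then 0 else unit_vect R x.
pose w := z - 'δ (inr P).
have wE x : x != inr P -> w$[x] = z$[x].
  by move=> xP; rewrite /w !entryE (negPf xP) subr0.
have ws : strict w by apply: strict_rows zs => i; rewrite wE.
have wP : w$[inr P] = -1 by rewrite /w !entryE eqxx zP.
have : lorentzian (hess (T r.+1) w).
  apply: (tower_lorentzian (nmax := 1)) => //; last by rewrite wP.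
  - exact: family_pos fF.
  - exact: family_alt fF.
  - by move=> *; apply: (family_ge0 fF).
  - by move=> *; apply: (family_lorentzian fF).
  - by move=> q qP; rewrite wE ?zo.
have hl := hess_bilinear (T r.+1) w.
have hz v : hess (T r.+1) w 0 v = 0.
  have := proj2 hl v (-1) 0 0; rewrite scaler0 addr0; lra.
apply: (@lorentzian_pullback _ _ _ e 1) => // x y; rewrite mul1r /e.
have AP t : t$[inr P] != 0 -> add_box F t = 0.
  move=> tP; apply/eqP; apply: contraNT tP => /Fs[_ _ ->//].
case: eqP => [->|/eqP xP].
  rewrite hz AP // !entryE eqxx zP; case: ifP => _; lia.
case: eqP => [->|/eqP yP].
  rewrite (proj1 hl) hz AP // !entryE eqxx zP; case: ifP => _; lia.
rewrite hess_unit tower1 /add_box.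
  apply: eq_bigr => i _; rewrite inord_val; congr F; apply: state_ext => d.
  by rewrite /w !(entryD, entryN); lia.
by rewrite !entryE eqxx (eq_sym _ x) (eq_sym _ y) (negPf xP) (negPf yP) zP.
Qed.

End AddBox.

End AddLetter.

(** * Adding a letter that may be traded for free boxes *)

Section PerturbedLetter.

Variables (R : realFieldType) (r m : nat) (P : 'I_m) (eps : R).
Local Notation I := ('I_r.+1 + 'I_m)%type.
Local Notation state := (state r m).
Local Notation vect := (vect R r m).
Implicit Types (F G H : state -> R) (z w : state) (d : I).

Definition without z : state := [ffun d => if d == inr P then 0 else z d].

Lemma entry_without z d : (without z)$[d] = if d == inr P then 0 else z$[d].
Proof. by rewrite /entry ffunE. Qed.

Lemma withoutB z d : d != inr P -> without (z - 'δ d) = without z - 'δ d.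
Proof.
move=> dP; apply: state_ext => x; rewrite !(entry_without, entryE).
by case: eqP => // ->; rewrite eq_sym (negPf dP) subr0.
Qed.

Lemma without_letter z : without (z - 'δ (inr P)) = without z.
Proof.
apply: state_ext => x; rewrite !(entry_without, entryE).
by case: eqP => // _; rewrite subr0.
Qed.

Lemma entry_sum_without z : entry_sum (without z) = entry_sum z - z$[inr P].
Proof.
rewrite /entry_sum (bigD1 (inr P)) //= [in RHS](bigD1 (inr P)) //=.
rewrite entry_without eqxx add0r [in RHS]addrAC subrr add0r; apply: eq_bigr => d dP.
by rewrite entry_without (negPf dP).
Qed.

(* The letter [P] is allowed to be deposited anywhere, at the price [eps] per
   occurrence; with [eps = 0] it is not used at all. *)
Definition seed F z : R :=
  if z$[inr P] <= 0
  then eps ^+ `|z$[inr P]| * iter `|z$[inr P]| (@add_box R r m) F (without z)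
  else 0.

Definition add_letter F : state -> R := tower P (seed F) r.+1.

Lemma seed_support F : letter_support P (seed F).
Proof. by move=> z zP; rewrite /seed leNgt zP. Qed.

(** One more [P] costs [eps] and adds one free box in any row, so coordinate [P] of the form depends
    linearly on the row coordinates. *)
Lemma seed_letter F z : z$[inr P] <= 0 ->
  seed F (z - 'δ (inr P)) = eps * \sum_(i : 'I_r.+1) seed F (z - 'δ (inl i)).
Proof.
move=> zP; rewrite /seed without_letter !entryE eqxx.
have -> : z$[inr P] - 1 <= 0 by lia.
have -> : `|(z$[inr P] - 1)%R|%N = `|z$[inr P]|.+1 by lia.
rewrite exprS -mulrA; congr (_ * _).
rewrite iterS /add_box mulr_sumr; apply: eq_bigr => i _.
by rewrite withoutB // !entryE /= !subr0 zP.
Qed.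

Lemma seed_positive_support F : positive_support F -> positive_support (seed F).
Proof.
move=> Fp z i zi; rewrite /seed; case: ifP => // _; set n := `|_|%N.
have {}Fp : positive_support (iter n (@add_box R r m) F).
  by elim: n => //= n; apply: add_box_pos.
by rewrite (Fp _ i) ?mulr0 // entry_without.
Qed.

Lemma seed_alternating F (i j : 'I_r.+1) :
  alternating_at i j F -> alternating_at i j (seed F).
Proof.
move=> Fa z; rewrite /seed entry_swap tpermD //; set n := `|_|%N.
have {}Fa : alternating_at i j (iter n (@add_box R r m) F).
  by elim: n => //= n; apply: add_box_alt.
have -> : without (swap_rows i j z) = swap_rows i j (without z).
  apply: state_ext => d; rewrite entry_swap !entry_without entry_swap.
  by case: tpermP => [->|->|].
by rewrite Fa mulrN; case: ifP => //; lra.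
Qed.

Section Family.

Variable F : state -> R.
Hypothesis eps0 : 0 < eps.
Hypothesis fF : weight_family (min_row_sum r) P F.
Local Notation T := (tower P (seed F)).

Lemma iter_add_box_family n :
  weight_family (min_row_sum r + n%:Z) P (iter n (@add_box R r m) F).
Proof.
elim: n => [|n IH]; first by rewrite addr0.
rewrite intS [1 + _]addrC addrA iterS; apply: add_box_family => //; lia.
Qed.

Let seed_pos := seed_positive_support (family_pos fF).

Let seed_alt (i j : 'I_r.+1) : i.+1 = j -> alternating_at i j (seed F).
Proof. by move=> ij; apply/seed_alternating/(family_alt fF). Qed.

Let seed_ge0 z : strict z -> 0 <= seed F z.
Proof.
move=> zs; rewrite /seed; case: ifP => // _.
rewrite mulr_ge0 ?exprn_ge0 ?(ltW eps0) //.
apply: (family_ge0 (iter_add_box_family _)).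
by apply: strict_rows zs => i; rewrite entry_without.
Qed.

(** All occurrences of [P] can be free boxes, so for [eps > 0] no dominance condition on the weight
    is needed. *)
Let seed_gt0 z : strict z -> entry_sum z = min_row_sum r ->
  (forall q : 'I_m, z$[inr q] <= 0) ->
  (forall q : 'I_m, (P < q)%N -> z$[inr q] = 0) -> 0 < seed F z.
Proof.
move=> zs zN z0 zp; rewrite /seed z0 mulr_gt0 ?exprn_gt0 //.
apply: (family_gt0 (iter_add_box_family _)).
- by apply: strict_rows zs => i; rewrite entry_without.
- by rewrite entry_sum_without zN; have := z0 P; lia.
- by move=> q; rewrite entry_without; case: ifP.
- move=> q; rewrite leq_eqVlt => /orP[/eqP/val_inj <-|/zp].
    by rewrite entry_without eqxx.
  by rewrite entry_without; case: ifP.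
Qed.

Let seed_supp z : seed F z != 0 ->
  [/\ entry_sum z = min_row_sum r, forall q : 'I_m, z$[inr q] <= 0 &
    forall q : 'I_m, (P.+1 <= q)%N -> z$[inr q] = 0].
Proof.
rewrite /seed; case: ifP => [zP|_]; last by rewrite eqxx.
rewrite mulf_eq0 negb_or => /andP[_ /(family_supp (iter_add_box_family _))].
rewrite entry_sum_without => -[h1 h2 h3]; split; first by lia.
  by move=> q; have := h2 q; rewrite entry_without; case: eqP => // -[->].
move=> q Pq; have := h3 q (ltnW Pq); rewrite entry_without.
by case: eqP => // -[E]; rewrite E ltnn in Pq.
Qed.

(** By [seed_letter] this is, up to a power of [eps], the form of an iterated [add_box] with [eps]
    times the sum of the row vectors substituted for the unit vector of [P]. *)
Let seed_lorentzian z : strict z -> lorentzian (hess (seed F) z).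
Proof.
move=> zs; have [zP|zP] := lerP z$[inr P] 0; last first.
  by apply: (letter_lorentzian (q := P) seed_supp); left.
pose n := `|z$[inr P]|%N; pose H := iter n (@add_box R r m) F.
have Hb := hess_bilinear H (without z).
pose s : vect := \sum_(i : 'I_r.+1) eps *: unit_vect R (inl i).
pose e x : vect := if x == inr P then s else unit_vect R x.
apply: (@lorentzian_pullback _ _ _ e (eps ^+ n) H (without z)); last first.
- apply: (family_lorentzian (iter_add_box_family _)).
  by apply: strict_rows zs => i; rewrite entry_without.
- have sE v : hess H (without z) s v =
      eps * \sum_(i : 'I_r.+1) hess H (without z) (unit_vect R (inl i)) v.
    rewrite mulr_sumr.
    exact: (linear_form_sum (fun=> eps) _ (proj2 Hb v)).
  have main x y : x != inr P -> y != inr P -> seed F (z - 'δ x - 'δ y) =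
      eps ^+ n * hess H (without z) (unit_vect R x) (unit_vect R y).
    move=> xP yP; rewrite hess_unit /seed !withoutB // !entryE.
    by rewrite (eq_sym _ x) (eq_sym _ y) (negPf xP) (negPf yP) !subr0 zP.
  have zxP x : x != inr P -> (z - 'δ x)$[inr P] <= 0.
    by move=> xP; rewrite !entryE eq_sym (negPf xP) subr0.
  have mainP y : y != inr P -> seed F (z - 'δ y - 'δ (inr P)) =
      eps ^+ n * hess H (without z) s (unit_vect R y).
    move=> yP; rewrite seed_letter ?zxP // sE mulrCA; congr (_ * _).
    by rewrite mulr_sumr; apply: eq_bigr => i _; rewrite addrAC main.
  move=> x y; rewrite /e; case: eqP => [->|/eqP xP].
    case: eqP => [->|/eqP yP]; last by rewrite addrAC mainP.
    rewrite seed_letter; last by rewrite !entryE eqxx; lia.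
    rewrite sE mulrCA; congr (_ * _); rewrite mulr_sumr; apply: eq_bigr => i _.
    by rewrite addrAC mainP // (proj1 Hb).
  case: eqP => [->|/eqP yP]; last exact: main.
  by rewrite mainP // (proj1 Hb).
- by rewrite exprn_ge0 // ltW.
Qed.

Let letter_supp k z : T k z != 0 ->
  [/\ entry_sum z = min_row_sum r, forall q : 'I_m, z$[inr q] <= 0 &
    forall q : 'I_m, (P.+1 <= q)%N -> z$[inr q] = 0].
Proof.
pose S z := [/\ entry_sum z = min_row_sum r, forall q : 'I_m, z$[inr q] <= 0 &
    forall q : 'I_m, (P.+1 <= q)%N -> z$[inr q] = 0].
apply: (tower_invariant (S := S) (seed_support F)); last exact: seed_supp.
move=> i t [h1 h2 h3]; split; first by rewrite -h1 entry_sum_shift.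
  by move=> q; have := h2 q; rewrite !entryE /=; case: ifP => _; lia.
move=> q Pq; have := h3 q Pq; rewrite !entryE.
by case: eqP => [E|_] /=; [rewrite E ltnn in Pq | lia].
Qed.

Let letter_gt0 k z : (k <= r.+1)%N -> strict z -> entry_sum z = min_row_sum r ->
  (forall q : 'I_m, z$[inr q] <= 0) ->
  (forall q : 'I_m, (P < q)%N -> z$[inr q] = 0) -> 0 < T k z.
Proof.
move=> kr zs zN z0 zq.
have := @tower_le _ _ _ _ _ (seed_support F) seed_pos seed_alt seed_ge0 0 k z.
by move=> /(_ (leq0n _) kr zs); apply: lt_le_trans; apply: seed_gt0.
Qed.

(** If the support conditions hold, [w] exceeds the minimal row sum and so has a corner; removing it
    gives a strict state of the right size, where the perturbed count is positive. *)
Let letter_connected (i : 'I_r.+1) z : strict z -> strict (z - 'δ (inl i)) ->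
  other_letters P z -> z$[inr P] < 0 ->
  [\/ exists d, T i (z - 'δ (inl i) - 'δ d) != 0,
      forall x y, T i (z - 'δ x - 'δ y) = 0 |
      forall x y,
        T i.+1 (z + ('δ (inr P) - 'δ (inl i)) - 'δ x - 'δ y) = 0].
Proof.
move=> zs zis zo zP.
have [zN|zN] := eqVneq (entry_sum z) (min_row_sum r + 2); last first.
  apply: Or32 => x y; apply/eqP; apply: contraNT zN => /letter_supp[].
  by rewrite !entry_sumB => h _ _; apply/eqP; lia.
have [/forallP zq|zq] :=
  boolP [forall q : 'I_m, (P < q)%N ==> (z$[inr q] == 0)]; last first.
  have {zq} [q Pq zq] : exists2 q : 'I_m, (P < q)%N & z$[inr q] != 0.
    rewrite negb_forall in zq; case/existsP: zq => q.
    by rewrite negb_imply => /andP[]; exists q.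
  have qP : q != P by apply: contraTneq Pq => ->; rewrite ltnn.
  have zq0 : z$[inr q] <= 0 by apply: zo.
  apply: Or32 => x y; apply/eqP; apply: contraNT zq => /letter_supp[_ _].
  move=> /(_ q Pq); rewrite !entryE => h; apply/eqP.
  by move: h; do 2!case: ifP => _; lia.
set w := z - 'δ (inl i).
have wE (q : 'I_m) : w$[inr q] = z$[inr q] by rewrite /w !entryE /= subr0.
have z0 (q : 'I_m) : z$[inr q] <= 0.
  by have [->|/zo//] := eqVneq q P; apply: ltW.
have wN : entry_sum w = min_row_sum r + 1 by rewrite /w entry_sumB zN; lia.
have [|d wd] := corner zis.
  have := @row_sum_ge _ _ w; rewrite wN => h.
  by apply: lt_le_trans (h _); [lia | move=> q; rewrite wE].
apply: Or31; exists (inl d); rewrite gt_eqF //; apply: letter_gt0 => //.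
- exact: ltnW.
- by rewrite entry_sumB wN; lia.
- by move=> q; rewrite /w !entryE /= !subr0.
- move=> q Pq; rewrite /w !entryE /= !subr0.
  by have := zq q; rewrite Pq => /eqP.
Qed.

Lemma add_letter_family : weight_family (min_row_sum r) P.+1 (add_letter F).
Proof.
split.
- exact: tower_positive_support.
- move=> i j ij; apply: tower_alternating => //; [exact: seed_support|].
  by rewrite ltn_ord.
- by move=> z; apply: letter_supp.
- by move=> z *; apply: letter_gt0.
move=> z zs; have [/forallP zo|] := boolP [forall q : 'I_m, z$[inr q] <= 0].
  apply: (tower_lorentzian (nmax := - z$[inr P])) => //.
  - exact: seed_support.
  - by move=> t *; apply: seed_lorentzian.
  - by move=> *; apply: letter_connected.
  - by rewrite opprK.
rewrite negb_forall => /existsP[q]; rewrite -ltNge => zq.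
by apply: (letter_lorentzian (q := q) (letter_supp (k := r.+1))); left.
Qed.

End Family.
End PerturbedLetter.

(** * The weight function and its perturbation *)

Section EmptyTableau.

Variables (R : realFieldType) (r m : nat).
Local Notation state := (state r m).
Implicit Types (z : state).

Lemma strict_diff z (i j : 'I_r.+1) : strict z -> (i <= j)%N ->
  z$[inl i] + j%:Z <= z$[inl j] + i%:Z.
Proof.
move=> zs; have [n] := ubnP j; elim: n j => // n IH j jn ij.
have [ij'|ij'] := eqVneq i j; first by rewrite ij'.
have jr : (j.-1 < r.+1)%N by have := ltn_ord j; lia.
pose k : 'I_r.+1 := Ordinal jr.
have ltij : (i < j)%N.
  by rewrite ltn_neqAle ij andbT; apply: contra ij' => /eqP E; apply/eqP/val_inj.
have kj : k.+1 = j by rewrite /= prednK //; lia.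
have := proj2 zs _ _ kj; have := IH k; lia.
Qed.

Lemma strict_ge z (i : 'I_r.+1) : strict z -> i.+1%:Z <= z$[inl i].
Proof.
by move=> zs; have := strict_diff zs (leq0n i : (@ord0 r <= i)%N);
  have := proj1 zs ord0 => /=; lia.
Qed.

Lemma strict_row_sum z : strict z -> min_row_sum r <= row_sum z.
Proof. by move=> zs; apply: ler_sum => i _; apply: strict_ge. Qed.

Lemma row_sum_unit z (i : 'I_r.+1) : row_sum (z - 'δ (inl i)) = row_sum z - 1.
Proof.
have := entry_sumB z (inl i); rewrite !entry_sumE.
have -> : \sum_(q < m) (z - 'δ (inl i))$[inr q] = \sum_(q < m) z$[inr q].
  by apply: eq_bigr => q _; rewrite !entryE /= subr0.
lia.
Qed.

Lemma strict_minimal z (i : 'I_r.+1) : strict z -> row_sum z = min_row_sum r ->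
  z$[inl i] = i.+1%:Z.
Proof.
move=> zs zN; have [[j _ /strict_row_sum]|] := corner_or_minimal zs (leqnn _).
  by rewrite row_sum_unit zN; lia.
by apply.
Qed.

(* The determinant is the sign of the permutation [i |-> z i - 1] of
   {0, ..., r}, and 0 if this is not a permutation. *)
Definition empty_weight z : R :=
  if [forall q : 'I_m, z$[inr q] == 0]
  then \det (\matrix_(i < r.+1, j < r.+1) (z$[inl i] == j.+1%:Z)%:R) else 0.

Lemma empty_weight_neq0 z : empty_weight z != 0 ->
  [/\ forall q : 'I_m, z$[inr q] = 0, row_sum z = min_row_sum r &
      forall i : 'I_r.+1, z$[inl i] <= r.+1%:Z].
Proof.
rewrite /empty_weight; case: ifP => [/forallP z0|_]; last by rewrite eqxx.
rewrite /determinant => h.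
have /existsP[s hs] : [exists s : 'S_r.+1, \prod_i
    (\matrix_(i < r.+1, j < r.+1) (z$[inl i] == j.+1%:Z)%:R : 'M[R]_r.+1)
      i (s i) != 0].
  apply: contraNT h; rewrite negb_exists => /forallP h; rewrite big1 // => s _.
  by have := h s; rewrite negbK => /eqP ->; rewrite mulr0.
have zs i : z$[inl i] = (s i).+1%:Z.
  apply/eqP; move/prodf_neq0: hs => /(_ i isT); rewrite mxE.
  by case: (z$[inl i] == _) => //; rewrite eqxx.
split=> [q|| i]; first exact/eqP.
  rewrite /min_row_sum (reindex_inj (@perm_inj _ s)) /=.
  by apply: eq_bigr => i _; rewrite zs.
by rewrite zs lez_nat.
Qed.

Lemma empty_weight1 z : (forall q : 'I_m, z$[inr q] = 0) ->
  (forall i : 'I_r.+1, z$[inl i] = i.+1%:Z) -> empty_weight z = 1.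
Proof.
move=> z0 zi; rewrite /empty_weight ifT; last by apply/forallP => q; rewrite z0.
rewrite -[RHS](det1 R r.+1); congr (\det _); apply/matrixP => i j.
by rewrite !mxE zi eqz_nat eqSS.
Qed.

Lemma empty_weight_family : weight_family (min_row_sum r) 0 empty_weight.
Proof.
have supp z : empty_weight z != 0 -> [/\ entry_sum z = min_row_sum r,
    forall q : 'I_m, z$[inr q] <= 0 &
    forall q : 'I_m, (0 <= q)%N -> z$[inr q] = 0].
  case/empty_weight_neq0 => z0 zN _; split=> [|q|q _]; rewrite ?z0 //.
  by rewrite entry_sumE zN big1 ?addr0.
split=> //.
- move=> z i zi; rewrite /empty_weight; case: ifP => // _.
  rewrite (expand_det_row _ i) big1 // => j _; rewrite mxE.
  have /negPf -> : z$[inl i] != j.+1%:Z by lia.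
  by rewrite mul0r.
- move=> i j ij z; rewrite /empty_weight.
  have -> : [forall q : 'I_m, (swap_rows i j z)$[inr q] == 0] =
      [forall q : 'I_m, z$[inr q] == 0].
    by apply: eq_forallb => q; rewrite entry_swap tpermD.
  case: ifP => _; last by rewrite oppr0.
  set A := (X in _ = - \det X).
  have -> : (\matrix_(k, l) ((swap_rows i j z)$[inl k] == l.+1%:Z)%:R) =
      xrow i j A.
    apply/matrixP => k l; rewrite !mxE entry_swap.
    by rewrite -(inj_tperm _ _ _ inl_inj).
  rewrite xrowE det_mulmx det_perm odd_tperm.
  have -> : i != j by apply/eqP => E; rewrite E in ij; lia.
  by rewrite expr1 mulN1r.
- move=> z zs zN _ zq; have z0 (q : 'I_m) : z$[inr q] = 0 by apply: zq.
  rewrite empty_weight1 // => i; apply: strict_minimal => //.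
  by rewrite -zN entry_sumE [X in _ + X]big1 ?addr0.
move=> z zs; have [/forallP z0|] := boolP [forall q : 'I_m, z$[inr q] == 0];
  last first.
  rewrite negb_forall => /existsP[q zq].
  by apply: (letter_lorentzian (q := q) supp); right.
(* Unless a unit is taken from the longest row, a nonzero value bounds that row by [r.+1], hence all
   rows by the staircase, although two units must be removed to reach its sum. *)
apply: (hess_lorentzian_at (d := inl ord_max)) => x y xr yr.
apply/eqP; apply: contraT => h.
have [_ _ /(_ ord_max)] := empty_weight_neq0 h; have [/esym + _ _] := supp _ h.
rewrite !entry_sumB !entryE (eq_sym _ x) (eq_sym _ y) (negPf xr) (negPf yr).
have -> : entry_sum z = row_sum z.
  by rewrite entry_sumE [X in _ + X]big1 ?addr0 // => q _; apply/eqP.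
rewrite !subr0 => zN zr.
suff : row_sum z <= min_row_sum r by lia.
apply: ler_sum => i _; have := strict_diff zs (leq_ord i : (i <= @ord_max r)%N).
by move: zr => /=; lia.
Qed.

End EmptyTableau.

(** * Letting the perturbation tend to 0 *)

Section Perturbation.

Variable R : realFieldType.

Definition is_polynomial (f : R -> R) := exists p : {poly R}, forall x, f x = p.[x].

Lemma polynomial_cst c : is_polynomial (fun=> c).
Proof. by exists c%:P => x; rewrite hornerC. Qed.

Lemma polynomial_exp n : is_polynomial (fun x => x ^+ n).
Proof. by exists 'X^n => x; rewrite hornerXn. Qed.

Lemma polynomialM f g : is_polynomial f -> is_polynomial g ->
  is_polynomial (fun x => f x * g x).
Proof. by move=> [p fp] [q gq]; exists (p * q) => x; rewrite hornerM fp gq. Qed.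

Lemma polynomialB f g : is_polynomial f -> is_polynomial g ->
  is_polynomial (fun x => f x - g x).
Proof. by move=> [p fp] [q gq]; exists (p - q) => x; rewrite hornerD hornerN fp gq. Qed.

Lemma polynomial_sum (J : finType) (f : J -> R -> R) :
  (forall j, is_polynomial (f j)) -> is_polynomial (fun x => \sum_j f j x).
Proof.
move=> fP; elim: (index_enum J) => [|j s [p hp]].
  by exists 0 => x; rewrite big_nil horner0.
by have [q hq] := fP j; exists (q + p) => x; rewrite big_cons hornerD hp hq.
Qed.

Lemma polynomial_ge0 f : is_polynomial f -> (forall x, 0 < x -> 0 <= f x) ->
  0 <= f 0.
Proof.
move=> [p fp] f0; rewrite leNgt; apply/negP => neg.
have {f0} p0 x : 0 < x -> 0 <= p.[x] by rewrite -fp; apply: f0.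
rewrite fp in neg; elim/poly_ind: p {fp} => [|p c _] in p0 neg *.
  by rewrite horner0 ltxx in neg.
rewrite !hornerE in neg.
pose M : R := \sum_(i < size p) `|p`_i|.
have M0 : 0 <= M by apply: sumr_ge0.
(* [M] bounds the cofactor of ['X] on the interval from 0 to 1, and this choice gives [0 < e <= 1]
   with [M * e + c < 0]. *)
pose e : R := - c / (1 + M - c).
have d0 : 0 < 1 + M - c by lra.
have e0 : 0 < e by rewrite /e divr_gt0 //; lra.
have e1 : e <= 1 by rewrite /e ler_pdivrMr //; lra.
have pM : p.[e] <= M.
  rewrite horner_coef; apply: ler_sum => i _.
  apply: le_trans (ler_norm _) _; rewrite normrM -[leRHS]mulr1.
  by rewrite ler_wpM2l // normrX exprn_ile1 // ger0_norm // ltW.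
have := p0 e e0; rewrite hornerMXaddC => h.
have h1 : p.[e] * e <= M * e by rewrite ler_pM2r.
have h2 : e * (1 + M - c) = - c by rewrite /e divfK // gt_eqF.
have h3 : 0 < e * - c by rewrite mulr_gt0 //; lra.
by lra.
Qed.

Variables (r m : nat).
Local Notation state := (state r m.+1).

Fixpoint weight (eps : R) (p : nat) : state -> R :=
  if p is p'.+1 then add_letter (inord p') eps (weight eps p')
  else @empty_weight R r m.+1.

Lemma weight_positive_support eps p : positive_support (weight eps p).
Proof.
elim: p => [|p IH]; first exact: family_pos (empty_weight_family _ _ _).
by apply: tower_positive_support; apply: seed_positive_support.
Qed.

Lemma weight_alternating eps p (i j : 'I_r.+1) : i.+1 = j ->
  alternating_at i j (weight eps p).
Proof.
elim: p i j => [|p IH] i j ij.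
  have h := family_alt (empty_weight_family R r m.+1) ij; exact: h.
apply: tower_alternating ij _ => //; first exact: seed_support.
  by move=> *; apply/seed_alternating/IH.
by rewrite ltn_ord.
Qed.

Lemma weight_is_family eps p : 0 < eps -> (p <= m.+1)%N ->
  weight_family (min_row_sum r) p (weight eps p).
Proof.
move=> eps0; elim: p => [|p IH] pm; first exact: empty_weight_family.
have E : (inord p : 'I_m.+1) = p :> nat by rewrite inordK.
rewrite -{1}E; apply: add_letter_family => //.
by rewrite E; apply: IH; apply: ltnW.
Qed.

Lemma weight_polynomial p z : is_polynomial (fun eps => weight eps p z).
Proof.
elim: p z => [|p IH] z; first exact: polynomial_cst.
have polyP (G : R -> state -> R) i : (forall z, is_polynomial (fun e => G e z)) ->
    forall z, is_polynomial (fun e => series (inord p) i (G e) z).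
  by move=> GP t; apply: polynomial_sum => k; apply: GP.
suff main k t : is_polynomial
    (fun e => tower (inord p) (seed (inord p) e (weight e p)) k t).
  exact: main.
elim: k t => [|k IHk] t /=; last exact: polyP.
rewrite /seed; case: (_ <= _); last exact: polynomial_cst.
apply: polynomialM; first exact: polynomial_exp.
move: `|_|%N => n; move: (without _ _); elim: n => [|n IHn] t' //=.
by apply: polynomial_sum => i; apply: IHn.
Qed.

(** For [eps > 0] this is [lorentzian_CS] for the form at [z]; the difference of the sides is a
    polynomial in [eps], so the inequality persists at 0. *)
Lemma weight_log_concave p z (a b : 'I_m.+1) : (p <= m.+1)%N -> strict z ->
  weight 0 p (z - 'δ (inr a) - 'δ (inr a)) *
    weight 0 p (z - 'δ (inr b) - 'δ (inr b)) <=
  weight 0 p (z - 'δ (inr a) - 'δ (inr b)) ^+ 2.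
Proof.
move=> pm zs; rewrite -subr_ge0.
pose W (x y : 'I_m.+1) eps := weight eps p (z - 'δ (inr x) - 'δ (inr y)).
have WP x y : is_polynomial (W x y) by exact: weight_polynomial.
apply: (@polynomial_ge0 (fun e => W a b e * W a b e - W a a e * W b b e)).
  by apply: polynomialB; apply: polynomialM.
move=> eps eps0; rewrite subr_ge0 -expr2 /W.
have fF := weight_is_family eps0 pm.
have ge0 x y : 0 <= weight eps p (z - 'δ (inr x) - 'δ (inr y)).
  by apply: (family_ge0 fF); apply: strict_rows zs => i; rewrite !entryE /= !subr0.
rewrite -!hess_unit; apply: lorentzian_CS; rewrite ?hess_unit //.
- exact: hess_bilinear.
- exact: (family_lorentzian fF).
Qed.

End Perturbation.

(** * Counting tableaux *)

Section Fillings.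

Variables (R : realFieldType) (r m B : nat).
Local Notation state := (state r m.+1).
Local Notation filling := {ffun 'I_r.+1 * 'I_B -> 'I_m.+2}.
Implicit Types (z : state) (T : filling) (i : 'I_r.+1) (c : 'I_B).

(* Tableaux are drawn in the rectangle ['I_r.+1 * 'I_B], the value [m.+1]
   standing for a blank. The row [i] has [z i - i.+1] cells, so that the rows
   come in order of increasing length. The letters are [< p] in the rows
   [>= k], and [<= p] in the rows [< k]. *)
Definition is_filling (p k : nat) z T : bool :=
  [&& [forall i : 'I_r.+1, forall c : 'I_B, (T (i, c) < m.+1)%N == ((c + i.+1)%:Z < z$[inl i])],
      [forall i : 'I_r.+1, forall c : 'I_B, forall c' : 'I_B,
        (c < c')%N ==> (T (i, c) <= T (i, c'))%N],
      [forall i : 'I_r.+1, forall i' : 'I_r.+1, forall c : 'I_B,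
        (i < i')%N && (T (i, c) < m.+1)%N ==> (T (i', c) < T (i, c))%N],
      [forall i : 'I_r.+1, forall c : 'I_B, (T (i, c) < m.+1)%N ==> (T (i, c) < p + (i < k))%N] &
      [forall q : 'I_m.+1, #|[set x | T x == q :> nat]|%:Z == - z$[inr q]]].

Lemma is_fillingP p k z T : reflect
  [/\ forall i c, (T (i, c) < m.+1)%N = ((c + i.+1)%:Z < z$[inl i]),
      forall i c (c' : 'I_B), (c < c')%N -> (T (i, c) <= T (i, c'))%N,
      forall i (i' : 'I_r.+1) c, (i < i')%N -> (T (i, c) < m.+1)%N ->
        (T (i', c) < T (i, c))%N,
      forall i c, (T (i, c) < m.+1)%N -> (T (i, c) < p + (i < k))%N &
      forall q : 'I_m.+1, #|[set x | T x == q :> nat]|%:Z = - z$[inr q]]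
  (is_filling p k z T).
Proof.
apply: (iffP and5P) => -[h1 h2 h3 h4 h5]; split.
- by move=> i c; move/forallP: h1 => /(_ i)/forallP/(_ c)/eqP.
- by move=> i c c'; apply/implyP; move/forallP: h2 => /(_ i)/forallP/(_ c)/forallP/(_ c').
- move=> i i' c ii' Tc; move/forallP: h3 => /(_ i)/forallP/(_ i')/forallP/(_ c).
  by rewrite ii' Tc.
- by move=> i c; apply/implyP; move/forallP: h4 => /(_ i)/forallP/(_ c).
- by move=> q; apply/eqP; move/forallP: h5 => /(_ q).
- by apply/forallP => i; apply/forallP => c; rewrite h1.
- by apply/forallP => i; apply/forallP => c; apply/forallP => c'; apply/implyP/h2.
- apply/forallP => i; apply/forallP => i'; apply/forallP => c.
  by apply/implyP => /andP[]; apply: h3.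
- by apply/forallP => i; apply/forallP => c; apply/implyP/h4.
- by apply/forallP => q; rewrite h5.
Qed.

Definition fillings p k z := [set T | is_filling p k z T].

Definition bounded z := forall i, z$[inl i] <= (B + i.+1)%:Z.

Definition update T x v : filling := [ffun y => if y == x then v else T y].

Lemma card_update T x v (q : nat) :
  (#|[set y | update T x v y == q :> nat]| + (T x == q :> nat) =
   #|[set y | T y == q :> nat]| + (v == q :> nat))%N.
Proof.
rewrite (cardsD1 x) [in RHS](cardsD1 x) !inE ffunE eqxx.
have -> : [set y | update T x v y == q :> nat] :\ x =
    [set y | T y == q :> nat] :\ x.
  by apply/setP => y; rewrite !inE ffunE; case: eqP.
lia.
Qed.

Lemma updateK T x v : update (update T x v) x (T x) = T.
Proof. by apply/ffunP => y; rewrite !ffunE; case: eqP => // ->. Qed.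

Section RemoveBox.

Variables (p k : nat).
Hypotheses (pm : (p <= m)%N) (kr : (k <= r)%N).
Local Notation P := (inord p : 'I_m.+1).
Local Notation i := (inord k : 'I_r.+1).
Local Notation letter := (inord p : 'I_m.+2).

Let iE : i = k :> nat. Proof. by rewrite inordK. Qed.
Let letterE : letter = p :> nat. Proof. by rewrite inordK //; lia. Qed.
Let PE : P = p :> nat. Proof. by rewrite inordK. Qed.

Lemma fillings_split z T : (T \in fillings p k z) =
  (T \in fillings p k.+1 z) && [forall c, T (i, c) != p :> nat].
Proof.
rewrite !inE; apply/idP/andP.
  move/is_fillingP => [h1 h2 h3 h4 h5]; split.
    by apply/is_fillingP; split=> // x c /h4; lia.
  apply/forallP => c; apply/eqP => E; have := h4 i c.
  by rewrite E iE ltnn addn0 ltnn ltnS pm => /(_ isT).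
case=> /is_fillingP[h1 h2 h3 h4 h5] /forallP h; apply/is_fillingP.
split=> // x c Tx; have [xi|xi] := eqVneq x i.
  by have := h4 x c Tx; have := h c; rewrite xi iE ltnn ltnSn /=; lia.
have := h4 x c Tx; have : (x != k :> nat).
  by apply: contra xi => /eqP E; apply/eqP/val_inj; rewrite /= iE.
lia.
Qed.

Variable z : state.
Hypotheses (zs : strict z) (zb : bounded z).
Local Notation z' := (z + ('δ (inr P) - 'δ (inl i))).

(** Row [k] is empty or as long as row [k-1]. In the latter case a [p] in row [k] would force a
    letter above [p] at the end of row [k-1], which admits only letters up to [p]. *)
Lemma remove_box_none : ~ strict (z - 'δ (inl i)) ->
  fillings p k.+1 z = fillings p k z.
Proof.
move=> nz; apply/setP => T; rewrite fillings_split.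
case Tz : (T \in _) => //=; apply/esym/forallP => c; apply/eqP => Tc.
move: Tz; rewrite inE => /is_fillingP[h1 h2 h3 h4 h5].
have ci : (c + i.+1)%:Z < z$[inl i] by rewrite -h1 Tc ltnS.
case: (strict_step i zs) => [//|[i0 zi]|[j ji zi]]; first by rewrite zi in ci; lia.
have cz : (0 <= z$[inl i] - i.+1%:Z - 1)%R by lia.
have c0B : (`|(z$[inl i] - i.+1%:Z - 1)%R| < B)%N by have := zb i; lia.
pose c0 : 'I_B := Ordinal c0B.
have c0E : c0%:Z = z$[inl i] - i.+1%:Z - 1 by rewrite /= gez0_abs.
have Tj : (T (j, c0) < m.+1)%N by rewrite h1; lia.
have := h3 j i c0 _ Tj; have := h4 j c0 Tj.
have jk : (j < k.+1)%N by lia.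
have : (T (i, c) <= T (i, c0))%N.
  have [cc|cc] := ltnP c c0; first exact: h2.
  have -> // : c = c0; apply: val_inj; rewrite /=; lia.
rewrite Tc jk /=; lia.
Qed.

(** The combinatorial form of [tower_rec]: [p] is the largest letter allowed in row [k], so it
    occurs there exactly when the last cell, in column [c0], holds it; that cell is then deleted. *)
Lemma remove_box : strict (z - 'δ (inl i)) ->
  #|fillings p k.+1 z| = (#|fillings p k z| + #|fillings p k.+1 z'|)%N.
Proof.
move=> zis.
have z'E (j : 'I_r.+1) : z'$[inl j] = z$[inl j] - (if j == i then 1 else 0).
  by rewrite !entryE /= sub0r.
have z'Q (q : 'I_m.+1) : z'$[inr q] = z$[inr q] + (q == P)%:Z.
  by rewrite !entryE /= subr0; case: (q == P).
have zi1 : i.+1%:Z < z$[inl i].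
  by have := strict_ge i zis; rewrite !entryE eqxx; lia.
have c0B : (`|(z$[inl i] - i.+1%:Z - 1)%R| < B)%N by have := zb i; lia.
pose c0 : 'I_B := Ordinal c0B.
have c0E : c0%:Z = z$[inl i] - i.+1%:Z - 1 by rewrite /=; lia.
pose x0 := (i, c0).
have lastP T : T \in fillings p k.+1 z ->
    [forall c, T (i, c) != p :> nat] = (T x0 != p :> nat).
  rewrite inE => /is_fillingP[h1 h2 h3 h4 h5].
  apply/forallP/idP => [/(_ c0)//|T0 c]; apply: contra T0 => /eqP Tc.
  have ci : (c + i.+1)%:Z < z$[inl i] by rewrite -h1 Tc ltnS.
  have T0 : (T x0 < m.+1)%N by rewrite h1; lia.
  have := h4 _ _ T0; rewrite iE ltnSn -/x0; have : (T (i, c) <= T x0)%N.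
    have [cc|cc] := ltnP c c0; first exact: h2.
    have -> // : c = c0; apply: val_inj; rewrite /=; lia.
  rewrite Tc /=; lia.
rewrite -(cardsID (fillings p k z) (fillings p k.+1 z)).
have -> : fillings p k.+1 z :&: fillings p k z = fillings p k z.
  by apply/setIidPr/subsetP => T; rewrite fillings_split => /andP[].
congr (_ + _)%N.
set A := _ :\: _.
have AP T : (T \in A) = (T \in fillings p k.+1 z) && (T x0 == p :> nat).
  rewrite in_setD fillings_split andbC; case Tz: (T \in _) => //=.
  by rewrite lastP // negbK.
pose del T := update T x0 ord_max.
have x0P (j : 'I_r.+1) c : ((j, c) == x0) = (j == i) && (c == c0) by [].
have delA T : T \in A -> del T \in fillings p k.+1 z'.
  rewrite AP !inE => /andP[/is_fillingP[h1 h2 h3 h4 h5] /eqP T0].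
  apply/is_fillingP; split.
  - move=> j c; rewrite z'E ffunE x0P; have [->|ji] := eqVneq j i.
      have [->|cc] := eqVneq c c0; first by rewrite /= ltnn; lia.
      have : (c != c0 :> nat) by [].
      by rewrite /= h1; lia.
    by rewrite /= subr0 h1.
  - move=> j c c' cc'; rewrite !ffunE !x0P; have [->|ji] := eqVneq j i => /=;
      last exact: h2.
    have [E|_] := eqVneq c c0.
      have [//|_] := eqVneq c' c0.
      rewrite leqNgt ltnS -ltnNge /=.
      have := h1 i c'; have := ltn_ord (T (i, c')).
      by rewrite E in cc'; lia.
    by have [_|_] := eqVneq c' c0; [rewrite -ltnS | exact: h2].
  - move=> j j' c jj'; rewrite !ffunE !x0P.
    have [_|jc] := boolP ((j == i) && (c == c0)).
      by rewrite /= ltnn.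
    move=> Tj; have [/andP[/eqP E1 /eqP E2]|jc'] := boolP ((j' == i) && (c == c0));
      last exact: h3.
    have := h3 _ _ _ jj' Tj; rewrite E1 E2 -/x0 T0; rewrite E2 in Tj.
    by have := h4 _ _ Tj; case: (j < k.+1)%N => /=; lia.
  - move=> j c; rewrite ffunE; case: eqP => [_|_]; first by rewrite /= ltnn.
    exact: h4.
  move=> q; have := card_update T x0 ord_max q; rewrite z'Q T0.
  have -> : (p == q) = (q == P) by rewrite eq_sym -(inj_eq val_inj) /= PE.
  have -> : (@ord_max m.+1 == q :> nat) = false by rewrite /= gtn_eqF.
  by have := h5 q; rewrite /del; lia.
have addA T : T \in fillings p k.+1 z' -> T x0 = ord_max /\
    update T x0 letter \in A.
  rewrite AP inE => /is_fillingP[h1 h2 h3 h4 h5].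
  have T0 : T x0 = ord_max.
    apply: val_inj; have := h1 i c0; rewrite z'E eqxx.
    by have := ltn_ord (T x0); rewrite /x0 /=; lia.
  split=> //; rewrite ffunE eqxx letterE eqxx andbT inE.
  (* Shorter rows do not reach column [c0], because the box removed from row [i] is a corner. *)
  have below (j : 'I_r.+1) : (j < i)%N -> ~ (T (j, c0) < m.+1)%N.
    move=> ji; have := strict_diff zis (ltnW ji); rewrite h1 z'E !entryE eqxx.
    have -> : (j == i) = false by apply/eqP => E; rewrite E ltnn in ji.
    by move: c0E; lia.
  apply/is_fillingP; split.
  - move=> j c; rewrite ffunE x0P; have := h1 j c; rewrite z'E.
    have [->|ji] := eqVneq j i; last by rewrite /= subr0.
    have [->|cc] := eqVneq c c0; first by rewrite /= letterE; lia.
    have : (c != c0 :> nat) by [].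
    by rewrite /= => + ->; lia.
  - move=> j c c' cc'; rewrite !ffunE !x0P; have [E|ji] := eqVneq j i => /=;
      last exact: h2.
    have [E2|_] := eqVneq c c0.
      have [//|_] := eqVneq c' c0.
      have := h2 i c c' cc'; rewrite E2 -/x0 T0 E letterE /=; lia.
    have [E2|_] := eqVneq c' c0; last exact: h2.
    have Tc : (T (j, c) < m.+1)%N.
      by rewrite h1 E z'E eqxx; rewrite E2 in cc'; lia.
    by have := h4 _ _ Tc; rewrite E letterE iE ltnSn /=; lia.
  - move=> j j' c jj'; rewrite !ffunE !x0P.
    have [/andP[/eqP E1 /eqP ->]|jc] := boolP ((j == i) && (c == c0)).
      rewrite -E1; have -> : (j' == j) = false.
        by apply/eqP => E; rewrite E ltnn in jj'.
      move=> _ /=; rewrite letterE.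
      have Tj : (T (j', c0) < m.+1)%N.
        rewrite h1 z'E; have -> : (j' == i) = false.
          by rewrite -E1; apply/eqP => E; rewrite E ltnn in jj'.
        by have := strict_diff zs (ltnW jj'); rewrite E1; lia.
      have := h4 _ _ Tj; have -> : (j' < k.+1)%N = false by rewrite E1 iE in jj'; lia.
      by rewrite addn0.
    move=> Tj; have [/andP[/eqP E1 /eqP E2]|jc'] := boolP ((j' == i) && (c == c0));
      last exact: h3.
    by rewrite E1 E2 in jj' Tj; case: (below _ jj').
  - move=> j c; rewrite ffunE x0P; case: andP => [[/eqP -> _]|_]; last exact: h4.
    by rewrite letterE iE ltnSn /=; lia.
  move=> q; have := card_update T x0 letter q; rewrite T0 letterE.
  have -> : (p == q) = (q == P) by rewrite eq_sym -(inj_eq val_inj) /= PE.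
  have -> : (@ord_max m.+1 == q :> nat) = false by rewrite /= gtn_eqF.
  by have := h5 q; rewrite z'Q; lia.
have del_inj : {in A &, injective del}.
  move=> T T' TA TA' E.
  have last (U : filling) : U \in A -> U x0 = letter.
    by rewrite AP => /andP[_ /eqP U0]; apply: val_inj; rewrite /= letterE.
  by rewrite -(updateK T x0 ord_max) -/(del T) E last // -(last _ TA') updateK.
rewrite -(card_in_imset del_inj); apply: eq_card => T.
apply/imsetP/idP => [[U /delA UA ->]//|Tz].
have [T0 TA] := addA _ Tz; exists (update T x0 letter) => //.
by rewrite /del -T0 updateK.
Qed.

End RemoveBox.
End Fillings.

(** * The unperturbed weight function counts fillings *)

Section WeightCount.

Variables (R : realFieldType) (r m B : nat).
Local Notation state := (state r m.+1).
Local Notation filling := {ffun 'I_r.+1 * 'I_B -> 'I_m.+2}.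
Implicit Types (z : state) (i : 'I_r.+1) (c : 'I_B).
Local Notation count p k z := #|fillings B p k z|.

Lemma fillings_letter_pos p k z (q : 'I_m.+1) :
  0 < z$[inr q] -> fillings B p k z = set0.
Proof.
move=> zq; apply/setP => T; rewrite !inE; apply/is_fillingP => -[_ _ _ _ h5].
by have := h5 q; lia.
Qed.

Lemma fillings_row0 p z (q : 'I_m.+1) : (p <= q)%N ->
  z$[inr q] != 0 -> fillings B p 0 z = set0.
Proof.
move=> pq zq; apply/setP => T; rewrite !inE; apply/is_fillingP.
move=> -[_ _ _ h4 h5].
case/negP: zq; rewrite -oppr_eq0 -h5 eqz_nat cards_eq0.
apply/eqP/setP => -[i c]; rewrite !inE; apply/negbTE/eqP => Tq.
have := h4 i c; rewrite Tq; have := ltn_ord q; lia.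
Qed.

Lemma fillings_next p z : fillings B p r.+1 z = fillings B p.+1 0 z.
Proof.
apply/setP => T; rewrite !inE; apply/is_fillingP/is_fillingP.
all: by move=> -[h1 h2 h3 h4 h5]; split=> // i c /h4; have := ltn_ord i; lia.
Qed.

Lemma empty_weight_count z : strict z -> bounded B z ->
  empty_weight R z = (count 0 0 z)%:R.
Proof.
move=> zs zb.
have [/forallP z0|] := boolP [forall q : 'I_m.+1, z$[inr q] == 0]; last first.
  rewrite negb_forall => /existsP[q zq]; rewrite (fillings_row0 _ zq) // cards0.
  apply/eqP; apply: contraR zq => /empty_weight_neq0[+ _ _].
  by move=> ->.
have [/forallP zi|] := boolP [forall i : 'I_r.+1, z$[inl i] == i.+1%:Z].
  have {}zi (i : 'I_r.+1) : z$[inl i] = i.+1%:Z by apply/eqP.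
  have {}z0 (q : 'I_m.+1) : z$[inr q] = 0 by apply/eqP.
  rewrite empty_weight1 //.
  rewrite (_ : fillings _ _ _ _ = [set [ffun=> ord_max]]) ?cards1 //.
  apply/setP => T; rewrite !inE; apply/is_fillingP/eqP => [[h1 _ _ _ _]|->].
    suff main i c : T (i, c) = ord_max by apply/ffunP => -[i c]; rewrite ffunE.
    apply: val_inj => /=; have := h1 i c.
    rewrite zi ltz_nat [X in _ = X]ltnNge leq_addl => /negbT; rewrite -leqNgt => h.
    by apply/eqP; rewrite eqn_leq h andbT -ltnS ltn_ord.
  split=> [i c|i c c' _|i i' c _|i c|q]; rewrite ?ffunE ?ltnn //=.
  - by rewrite zi; lia.
  - rewrite z0 oppr0; apply/eqP; rewrite eqz_nat cards_eq0.
    apply/eqP/setP => x; rewrite !inE ffunE /=.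
    by have := ltn_ord q; lia.
rewrite negb_forall => /existsP[i zi].
rewrite (_ : fillings _ _ _ _ = set0) ?cards0; last first.
  apply/setP => T; rewrite !inE; apply/is_fillingP => -[h1 _ _ h4 _].
  have B0 : (0 < B)%N by have := zb i; have := strict_ge i zs; lia.
  by have := h4 i (Ordinal B0); rewrite h1 /=; have := strict_ge i zs; lia.
apply/eqP; apply: contraR zi => /empty_weight_neq0[_ zN _].
by rewrite (strict_minimal i zs zN).
Qed.

(** Towers and fillings obey the same recursion. When row [k] has no removable box, the shifted
    tower vanishes by support or antisymmetry, in agreement with [remove_box_none]. *)
Lemma tower_count p k z : (p <= m)%N ->
  (forall z, strict z -> bounded B z -> weight 0 p z = (count p 0 z)%:R :> R) ->
  (k <= r.+1)%N -> strict z -> bounded B z ->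
  tower (inord p) (seed (inord p) (0 : R) (weight 0 p)) k z = (count p k z)%:R.
Proof.
move=> pm IHp; set P : 'I_m.+1 := inord p; set G := seed _ _ _.
have PE : P = p :> nat by rewrite inordK.
have Gl : letter_support P G by exact: seed_support.
have Gp : positive_support G.
  by apply/seed_positive_support/weight_positive_support.
have Ga (i j : 'I_r.+1) : i.+1 = j -> alternating_at i j G.
  by move=> ij; apply/seed_alternating/weight_alternating.
elim: k z => [|k IH] z kr.
  move=> zs zb; rewrite /= /G /seed.
  have [zP|zP] := lerP z$[inr P] 0; last by rewrite (fillings_letter_pos _ _ zP) cards0.
  (* As [0 ^+ 0 = 1], the seed at [eps = 0] is the previous weight where [P] is absent, and 0
     elsewhere. *)
  have [z0|z0] := eqVneq z$[inr P] 0.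
    rewrite z0 mul1r /= -IHp //; congr (weight 0 p _).
    by apply: state_ext => d; rewrite entry_without; case: eqP => // ->.
  rewrite (fillings_row0 _ z0) ?PE // cards0.
  by rewrite expr0n absz_eq0 (negPf z0) mul0r.
pose i : 'I_r.+1 := inord k; have ik : i = k :> nat by rewrite inordK.
elim/(@letter_ind _ _ P i): z => z zP.
  by move=> _ _; rewrite (tower_support Gl) // (fillings_letter_pos _ _ zP) cards0.
set z' := z + _ => IHz zs zb.
rewrite tower_rec // IH //; last exact: ltnW.
have z'E j : z'$[inl j] = z$[inl j] - (if j == i then 1 else 0).
  by rewrite /z' !entryE /= sub0r.
have zz' : strict (z - 'δ (inl i)) -> strict z'.
  by apply: strict_rows => j; rewrite z'E !entryE.
have Ta (j j' : 'I_r.+1) : (j' <= i)%N -> j.+1 = j' ->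
    alternating_at j j' (tower P G k.+1).
  by move=> ji jj'; apply: tower_alternating => //; lia.
have none : ~ strict (z - 'δ (inl i)) -> tower P G k.+1 z' = 0 ->
    (count p k z)%:R + tower P G k.+1 z' = (count p k.+1 z)%:R.
  by move=> nz ->; rewrite addr0 remove_box_none.
rewrite -/i -/z'; case: (strict_step i zs) => [h|[i0 zi]|[j ji zi]].
- rewrite remove_box // natrD IHz //; first exact: zz'.
  by move=> j; have := zb j; rewrite z'E; case: ifP => _; lia.
- apply: none => [/(proj1)/(_ i)|]; first by rewrite !entryE eqxx zi.
  by apply: (@tower_positive_support _ _ _ _ _ Gp _ _ i); rewrite z'E eqxx zi.
have ij : (j == i) = false by apply/eqP => E; rewrite E in ji; lia.
apply: none => [/(proj2)/(_ _ _ ji)|]; first by rewrite !entryE eqxx ij zi; lia.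
by apply: (alternating_eq0 (Ta j i _ ji)) => //; rewrite !z'E eqxx ij zi; lia.
Qed.

Lemma weight_count p z : (p <= m.+1)%N -> strict z -> bounded B z ->
  weight 0 p z = (count p 0 z)%:R :> R.
Proof.
elim: p z => [|p IH] z pm; first exact: empty_weight_count.
move=> zs zb; rewrite -fillings_next; apply: tower_count => // t *.
by apply: IH => //; apply: ltnW.
Qed.

End WeightCount.

(** * Fillings and semistandard tableaux *)

Section Kostka.

Variables (la : seq nat) (m : nat).
Hypothesis la_part : is_partition la.

Local Notation r := (size la).
Local Notation B := (sumn la).
Local Notation filling := {ffun 'I_r.+1 * 'I_B -> 'I_m.+2}.

Lemma nth_partition i j : (i <= j)%N -> (nth 0 la j <= nth 0 la i)%N.
Proof.
move=> ij; have [jr|jr] := ltnP j r; last by rewrite nth_default.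
have gtr : transitive geq by move=> a b c ab bc; apply: leq_trans bc ab.
apply: (sorted_leq_nth gtr leqnn 0%N la_part) => //; rewrite inE //.
exact: leq_ltn_trans jr.
Qed.

Lemma nth_le_sumn i : (nth 0 la i <= B)%N.
Proof.
elim: la i => [|a l IH] [|i] //=; first exact: leq_addr.
exact: leq_trans (IH i) (leq_addl _ _).
Qed.

(* Row [i] is the [(size la - i)]-th row of the diagram; row [0] is empty. *)
Definition kostka_state (nu : 'rV[int]_m.+1) : state r m.+1 :=
  [ffun d : 'I_r.+1 + 'I_m.+1 => match d with
    | inl i => (nth 0 la (r - i) + i.+1)%N%:Z
    | inr q => - nu ord0 q
    end].

Lemma kostka_state_row nu i :
  (kostka_state nu)$[inl i] = (nth 0 la (r - i) + i.+1)%N%:Z.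
Proof. by rewrite /entry ffunE. Qed.

Lemma kostka_state_letter nu q : (kostka_state nu)$[inr q] = - nu ord0 q.
Proof. by rewrite /entry ffunE. Qed.

Lemma kostka_state_strict nu : strict (kostka_state nu).
Proof.
split=> [i|i j ij]; rewrite !kostka_state_row; first by lia.
have : (nth 0 la (r - i) <= nth 0 la (r - j))%N by apply: nth_partition; lia.
lia.
Qed.

Lemma kostka_state_bounded nu : bounded B (kostka_state nu).
Proof. by move=> i; rewrite kostka_state_row; have := nth_le_sumn (r - i); lia. Qed.

Definition cell_at (x : 'I_r.+1 * 'I_B) : option (cell la) :=
  [pick d : cell la | (cell_row d + x.1 == r)%N && (cell_col d == x.2 :> nat)].

Definition mk_cell i j (ir : (i < r)%N) (jl : (j < nth 0 la i)%N) : cell la :=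
  Tagged (fun i' : 'I_r => 'I_(nth 0%N la i')) (Ordinal jl : 'I_(nth 0%N la (Ordinal ir))).

Lemma cell_inj (d e : cell la) :
  cell_row d = cell_row e -> cell_col d = cell_col e -> d = e.
Proof.
case: d e => [i j] [i' j']; rewrite /cell_row /cell_col /= => ii'.
have {}ii' : i = i' by apply: val_inj.
by case: i' / ii' j' => j' /= jj'; congr (Tagged _ _); apply: val_inj.
Qed.

Lemma cell_at_spec (i : 'I_r.+1) (c : 'I_B) :
  match cell_at (i, c) with
  | Some d => (cell_row d + i = r)%N /\ cell_col d = c
  | None => (nth 0 la (r - i) <= c)%N
  end.
Proof.
rewrite /cell_at; case: pickP => [d /andP[/eqP h1 /eqP h2]|h] //.
rewrite leqNgt; apply/negP => ci.
have ri : (r - i < r)%N.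
  by rewrite ltnNge; apply/negP => h'; rewrite nth_default in ci.
have := h (mk_cell ri ci); rewrite /cell_row /cell_col /= eqxx andbT.
by have := ltn_ord i; lia.
Qed.

Lemma cell_col_lt (d : cell la) : (cell_col d < nth 0 la (cell_row d))%N.
Proof. by case: d => i j; apply: ltn_ord. Qed.

Lemma cell_row_lt (d : cell la) : (cell_row d < r)%N.
Proof. by case: d => i j; apply: ltn_ord. Qed.

Lemma cell_point_subproof (d : cell la) : (cell_col d < B)%N.
Proof. exact: leq_trans (cell_col_lt d) (nth_le_sumn _). Qed.

Definition point (d : cell la) : 'I_r.+1 * 'I_B :=
  (inord (r - cell_row d), Ordinal (cell_point_subproof d)).

Lemma point_row d : (point d).1 = (r - cell_row d)%N :> nat.
Proof. by rewrite inordK //; lia. Qed.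

Lemma pointK : pcancel point cell_at.
Proof.
move=> d; have := cell_at_spec (point d).1 (point d).2.
rewrite -surjective_pairing; case: (cell_at _) => [e [e1 e2]|].
  congr Some; apply: cell_inj => //; rewrite point_row in e1.
  by have := cell_row_lt d; have := cell_row_lt e; lia.
have -> : (r - (point d).1)%N = cell_row d.
  by rewrite point_row subKn // ltnW // cell_row_lt.
by move=> h; have := cell_col_lt d; rewrite ltnNge h.
Qed.

Lemma cell_at_point x d : cell_at x = Some d -> x = point d.
Proof.
case: x => i c E; have := cell_at_spec i c; rewrite E => -[h1 h2].
congr (_, _); apply: val_inj => //=.
by rewrite inordK; lia.
Qed.

Definition draw (T : {ffun cell la -> 'I_m.+1}) : filling :=
  [ffun x => if cell_at x is Some d then widen_ord (leqnSn _) (T d) else ord_max].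

Lemma draw_point T d : draw T (point d) = T d :> nat.
Proof. by rewrite ffunE pointK. Qed.

Lemma draw_inj : injective draw.
Proof.
move=> T T' E; apply/ffunP => d; apply: val_inj => /=.
by rewrite -!draw_point E.
Qed.

Lemma draw_nonblank T x : (draw T x < m.+1)%N = (cell_at x != None).
Proof. by rewrite ffunE; case: (cell_at x) => [d|] /=; rewrite ?ltnn ?ltn_ord. Qed.

Lemma content_draw T (q : 'I_m.+1) : #|[set x | draw T x == q :> nat]| = content T q.
Proof.
rewrite /content -(card_imset _ (pcan_inj pointK)); apply: eq_card => x.
rewrite inE; apply/eqP/imsetP => [E|[d + ->]].
  case Ex : (cell_at x) => [d|].
    exists d; last exact: cell_at_point.
    rewrite inE; apply/eqP/val_inj => /=; rewrite -E.
    by rewrite (cell_at_point Ex) draw_point.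
  by have := ltn_ord q; rewrite -E draw_nonblank Ex.
by rewrite inE => /eqP <-; rewrite draw_point.
Qed.

Lemma cell_at_nonblank nu (i : 'I_r.+1) (c : 'I_B) :
  (cell_at (i, c) != None) = ((c + i.+1)%:Z < (kostka_state nu)$[inl i]).
Proof.
rewrite kostka_state_row; have := cell_at_spec i c.
case: (cell_at _) => [d [h1 h2]|] /=; last by lia.
have := cell_col_lt d; have -> : cell_row d = (r - i)%N by lia.
by rewrite h2; lia.
Qed.

(** The rows are reversed, so columns decrease strictly with the row index; blanks carry the largest
    value, so rows stay weakly increasing past their end. *)
Lemma draw_filling nu T :
  is_filling m.+1 0 (kostka_state nu) (draw T) =
  semistandard T && [forall k, (content T k)%:Z == nu ord0 k].
Proof.
apply/is_fillingP/andP => [[h1 h2 h3 h4 h5]|[/forallP sst /forallP cont]].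
  split; last first.
    apply/forallP => k; rewrite -content_draw h5 kostka_state_letter opprK.
    exact: eqxx.
  apply/forallP => d; apply/forallP => e; apply/andP; split.
    apply/implyP => /andP[/eqP de cde]; rewrite -!draw_point.
    have E : (point d).1 = (point e).1 by rewrite /point de.
    rewrite [point d]surjective_pairing [point e]surjective_pairing E.
    exact: h2.
  apply/implyP => /andP[/eqP de rde].
  have E : (point d).2 = (point e).2 by apply: val_inj.
  have := h3 (point e).1 (point d).1 (point e).2.
  rewrite -{2}E -!surjective_pairing !draw_point !point_row; apply.
    by have := cell_row_lt d; have := cell_row_lt e; lia.
  exact: ltn_ord.
split.
- by move=> i c; rewrite draw_nonblank (cell_at_nonblank nu).
- move=> i c c' cc'; rewrite !ffunE.
  have := cell_at_spec i c; have := cell_at_spec i c'.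
  case: (cell_at (i, c')) => [e|] /=; last first.
    by case: (cell_at _) => [d|] /= _ _; rewrite ?leqnn // ltnW.
  move=> [e1 e2]; case: (cell_at _) => [d [d1 d2]|h] /=.
    have := sst d => /forallP/(_ e)/andP[/implyP + _]; apply.
    by rewrite d2 e2 cc' andbT; apply/eqP; lia.
  have := cell_col_lt e; have -> : cell_row e = (r - i)%N by lia.
  by rewrite e2; lia.
- move=> i i' c ii'; rewrite !ffunE.
  have := cell_at_spec i c; have := cell_at_spec i' c.
  case: (cell_at (i, c)) => [d|]; last by rewrite ltnn.
  case: (cell_at (i', c)) => [e [e1 e2] [d1 d2] _ /=|h [d1 d2] _].
    have := sst e => /forallP/(_ d)/andP[_ /implyP]; apply.
    by rewrite d2 e2 eqxx /=; lia.
  have := cell_col_lt d; have -> : cell_row d = (r - i)%N by lia.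
  have : (nth 0 la (r - i) <= nth 0 la (r - i'))%N by apply: nth_partition; lia.
  lia.
- by move=> i c; rewrite addn0.
- move=> q; rewrite content_draw kostka_state_letter opprK.
  by apply/eqP.
Qed.

Lemma kostka_count nu :
  kostka la nu = #|fillings B m.+1 0 (kostka_state nu)|.
Proof.
rewrite /kostka -(card_imset _ draw_inj); apply: eq_card => U.
apply/imsetP/idP => [[T + ->]|]; first by rewrite !inE draw_filling.
rewrite inE => Uf; have /is_fillingP[h1 _ _ _ _] := Uf.
pose T : {ffun cell la -> 'I_m.+1} := [ffun d => inord (U (point d))].
suff UT : U = draw T by exists T => //; rewrite inE -draw_filling -UT.
apply/ffunP => -[i c]; apply: val_inj; rewrite [in RHS]ffunE /=.
have := h1 i c; rewrite -(cell_at_nonblank nu).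
case Ex : (cell_at _) => [d|] Ui /=.
  by rewrite ffunE -(cell_at_point Ex) inordK.
move/negbT: Ui; rewrite -leqNgt => Ui.
by apply/eqP; rewrite eqn_leq Ui andbT -ltnS ltn_ord.
Qed.

End Kostka.

Theorem theorem2 (la : seq nat) (m : nat) (mu : 'rV[nat]_m) (i j : 'I_m) :
  is_partition la -> (1 <= m)%N -> i != j ->
  (kostka la (map_mx Posz mu) ^ 2 >=
     kostka la (shift_weight (map_mx Posz mu) i j) *
     kostka la (shift_weight (map_mx Posz mu) j i))%N.
Proof.
case: m mu i j => // m mu i j la_part _ ij.
pose z := kostka_state la (map_mx Posz mu).
(* Letter entries are minus multiplicities: subtracting the unit of [i] twice from this state leaves
   the weight [mu + e_i - e_j], and subtracting both units leaves [mu]. *)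
have zs : strict (z + 'δ (inr i) + 'δ (inr j)).
  apply: strict_rows (kostka_state_strict la_part (map_mx Posz mu)) => k.
  by rewrite !entryE /= !addr0.
have := @weight_log_concave rat (size la) m m.+1 _ i j (leqnn _) zs.
have shiftE (a b : 'I_m.+1) : a != b -> z + 'δ (inr i) + 'δ (inr j)
    = z + 'δ (inr a) + 'δ (inr b) ->
    z + 'δ (inr i) + 'δ (inr j) - 'δ (inr a) - 'δ (inr a) =
    kostka_state la (shift_weight (map_mx Posz mu) a b).
  move=> ab ->; apply: state_ext => -[k|q].
    by rewrite !entryE /= !kostka_state_row !(subr0, addr0).
  rewrite !entryE !kostka_state_letter /shift_weight !mxE eqxx /=.
  by case: (q == a); case: (q == b) => /=; lia.
rewrite (shiftE i j) // (shiftE j i) 1?eq_sym //; last by rewrite addrAC.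
have -> : z + 'δ (inr i) + 'δ (inr j) - 'δ (inr i) - 'δ (inr j) = z.
  by rewrite addrAC addrK addrAC subrK.
rewrite !(@weight_count _ _ _ (sumn la)) //; try exact: kostka_state_strict;
  try exact: kostka_state_bounded.
by rewrite -!kostka_count // -natrM -natrX ler_nat.
Qed.
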